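(* Suppose that $\phi_q(\lambda)\to\infty$ as $\lambda\to\infty$ for every $q\in T$. Let $\{\sigma(q):q\in T\}$ be the total mass process either of a Markov process $\{Z_q:q\in T\}$ with transition semigroup $\{\mathbf{Q}_{p,q}\}$ or $\{\mathbf{Q}^\infty_{p,q}\}$, i.e. $\sigma(q)=Z_q[0,\infty)$, or of a Markov process $\{(X_t(q))_{t\ge0}:q\in T\}$ with transition semigroup $\{\mathbf{P}_{p,q}\}$ or $\{\mathbf{P}^\infty_{p,q}\}$, i.e. $\sigma(q)=\int_0^\infty X_s(q)\,ds$; regard $\sigma$ as a process with state space $\mathbb{R}_+$ and cemetery $\infty$. Then $\{\sigma(q):q\in T\}$ is an inhomogeneous Markov process with transition semigroup $\{R_{p,q}:q\ge p\in T\}$ such that, for $\lambda\ge 0$ and $x\ge0$, $$\int_{\mathbb{R}_+}e^{-\lambda y}R_{p,q}(x,dy)=\exp\bigl\{-x\phi_p\bigl(\phi_q^{-1}(\lambda)\bigr)-\mu(p,q]\,\phi_q^{-1}(\lambda)\bigr\}.$$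
   Context: ''Positive'' means nonnegative, ''increasing/decreasing'' are in the weak sense, $\int_a^b=\int_{(a,b]}$, $\int_a^\infty=\int_{(a,\infty)}$, $\langle\nu,f\rangle=\int f\,d\nu$. $B^+[0,\infty)$ is the set of bounded positive Borel functions on $[0,\infty)$; $D^+[0,\infty)$ is the space of positive càdlàg paths on $[0,\infty)$ with the Skorokhod topology; $D^+_{\mathrm{in}}[0,\infty)$ is the subset of integrable paths; $M[0,\infty)$ is the space of finite Borel measures and $\mathscr{M}[0,\infty)$ the space of Radon measures on $[0,\infty)$ (vague topology). A branching mechanism is a function $\phi(\lambda)=b\lambda+\frac12\sigma^2\lambda^2+\int_0^\infty(e^{-z\lambda}-1+z\lambda)m(dz)$, $\lambda\ge0$, with constants $\sigma\ge0$, $b\in\mathbb{R}$, and $(z\wedge z^2)m(dz)$ a finite measure on $(0,\infty)$. Let $T\subset\mathbb{R}$ be an interval, and let $\{\phi_q:q\in T\}$ be an admissible family of branching mechanisms: $\phi_q$ has parameters $(b,m)=(b_q,m_q)$ depending on $q$ (with the constant $\sigma$ fixed), and for each $\lambda\ge 0$ the function $q\mapsto\phi_q(\lambda)$ is decreasing and continuously differentiable with $\zeta_q(\lambda):=-\frac{\partial}{\partial q}\phi_q(\lambda)=\beta_q\lambda+\int_0^\infty(1-e^{-z\lambda})n_q(dz)$, where $\beta_q\ge0$ and $n_q(dz)$ is a $\sigma$-finite kernel from $T$ to $(0,\infty)$ with $\sup_{p\le\theta\le q}[\beta_\theta+\int_0^\infty z\,n_\theta(dz)]<\infty$ for all $p\le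 q\in T$. Put $\phi_{p,q}=\phi_p-\phi_q$ for $p\le q$, and $\phi_q^{-1}(\lambda)=\inf\{z\ge0:\phi_q(z)>\lambda\}$. Let $\mu$ be a positive right continuous increasing function on $T$, $\mu(p,q]=\mu(q)-\mu(p)$. For $f\in B^+[0,\infty)$ with compact support, $s\mapsto u_q(s,f)$ is the unique compactly supported bounded positive solution on $[0,\infty)$ of $u_q(s)+\int_s^\infty\phi_q(u_q(t))\,dt=\int_s^\infty f(t)\,dt$, and $u_{p,q}(s,f)=f(s)+\phi_{p,q}(u_q(s,f))$. $\{\mathbf{Q}_{p,q}:q\ge p\in T\}$ is the Markov transition semigroup on $\mathscr{M}[0,\infty)$ with $\int e^{-\langle\nu,f\rangle}\mathbf{Q}_{p,q}(\eta,d\nu)=\exp\{-\mu(p,q]u_q(0,f)-\langle\eta,u_{p,q}(\cdot,f)\rangle\}$ for compactly supported $f\in B^+[0,\infty)$. $\{\mathbf{P}_{p,q}\}$ is the Markov transition semigroup on $D^+[0,\infty)$ with $\int e^{-\int_0^\infty f(s)w(s)ds}\mathbf{P}_{p,q}(\rho,dw)=\exp\{-\mu(p,q]u_q(0,f)-\int_0^\infty u_{p,q}(s,f)\rho(s)ds\}$ for the same $f$ (i.e. the restriction of $\mathbf{Q}_{p,q}$ to measures $w(s)ds$ with $w\in D^+[0,\infty)$). $\{\mathbf{Q}^\infty_{p,q}\}$ and $\{\mathbf{P}^\infty_{p,q}\}$ are the sub-Markov restrictions of $\{\mathbf{Q}_{p,q}\}$ to $M[0,\infty)$ and of $\{\mathbf{P}_{p,q}\}$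 to $D^+_{\mathrm{in}}[0,\infty)$, respectively (processes with these semigroups are sent to a cemetery, where the total mass is $\infty$, upon leaving these spaces). *)

(* Defs.v *)
From HB Require Import structures.
From mathcomp Require Import all_boot all_order all_algebra.
From mathcomp Require Import all_classical all_reals all_analysis.

Set Implicit Arguments.
Unset Strict Implicit.
Unset Printing Implicit Defensive.

Import Order.TTheory GRing.Theory Num.Theory.
Import numFieldNormedType.Exports.

Local Open Scope classical_set_scope.
Local Open Scope ring_scope.

(* Functions, measures and paths on the half-line [0, oo) are represented by
   functions and measures on R: functions are only ever evaluated on [0, oo),
   measures give no mass to (-oo, 0), paths vanish on (-oo, 0). *)

Definition branching_mechanism (R : realType) (b sigma : R)
    (m : {measure set (measurableTypeR R) -> \bar R}) (lam : R) : R :=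
  b * lam + 2^-1 * sigma ^+ 2 * lam ^+ 2
  + \int[m]_(z in `]0, +oo[) (expR (- (z * lam)) - 1 + z * lam).

Definition branching_params (R : realType) (sigma : R)
    (m : {measure set (measurableTypeR R) -> \bar R}) : Prop :=
  0 <= sigma /\ (\int[m]_(z in `]0%R, +oo[) (Num.min z (z ^+ 2))%:E < +oo)%E.

Definition zeta (R : realType) (beta : R)
    (n : {measure set (measurableTypeR R) -> \bar R}) (lam : R) : R :=
  beta * lam + \int[n]_(z in `]0, +oo[) (1 - expR (- (z * lam))).

(* The difference quotient is taken along [within T], so that the derivative
   in [q] is one-sided at an end point of [T] belonging to [T]. *)
Definition admissible_family (R : realType) (T : set R) (phi : R -> R -> R) :
    Prop :=
  exists (sigma : R) (b : R -> R)
    (m : R -> {measure set (measurableTypeR R) -> \bar R})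
    (beta : R -> R) (n : R.-sigmafker (measurableTypeR R) ~> (measurableTypeR R)),
  [/\ (forall q, T q -> branching_params sigma (m q)) /\
      (forall q lam, T q -> 0 <= lam ->
         phi q lam = branching_mechanism (b q) sigma (m q) lam),
      forall p q lam, T p -> T q -> p <= q -> 0 <= lam -> phi q lam <= phi p lam,
      forall q lam, T q -> 0 <= lam ->
        (fun p => (phi p lam - phi q lam) / (p - q)) @ within T q^' -->
          - zeta (beta q) (n q) lam,
      forall lam, 0 <= lam ->
        {within T, continuous (fun q => zeta (beta q) (n q) lam)} &
      (forall q, T q -> 0 <= beta q) /\
      (forall p q, T p -> T q -> p <= q ->
         (ereal_sup [set ((beta th)%:E + \int[n th]_(z in `]0%R, +oo[) z%:E)%E
                    | th in `[p, q]] < +oo)%E)].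

Definition phi_inv (R : realType) (phi : R -> R) (lam : R) : R :=
  inf [set z | 0 <= z /\ lam < phi z].

Definition immigration_function (R : realType) (T : set R) (mu : R -> R) :
    Prop :=
  [/\ forall q, T q -> 0 <= mu q,
      forall p q, T p -> T q -> p <= q -> mu p <= mu q &
      forall q, T q -> mu @ within T q^'+ --> mu q].

(* elements of B^+[0, oo) with compact support *)
Definition bounded_pos_csupp (R : realType) (f : R -> R) : Prop :=
  [/\ measurable_fun (`[0, +oo[ : set (measurableTypeR R))
        (f : measurableTypeR R -> measurableTypeR R),
      forall s, 0 <= s -> 0 <= f s,
      exists C, forall s, 0 <= s -> f s <= C &
      exists N, forall s, N < s -> f s = 0].

Definition backward_solution (R : realType) (phi f u : R -> R) : Prop :=
  bounded_pos_csupp u /\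
  forall s, 0 <= s ->
    u s + \int[@lebesgue_measure R]_(t in `]s, +oo[) phi (u t)
    = \int[@lebesgue_measure R]_(t in `]s, +oo[) f t.

(* The unique solution (up to its irrelevant values on (-oo, 0)). *)
Definition u_ (R : realType) (phi f : R -> R) : R -> R :=
  xget (cst 0) [set u | backward_solution phi f u].

Definition u2_ (R : realType) (phi : R -> R -> R) (p q : R) (f : R -> R)
    (s : R) : R :=
  f s + (phi p (u_ (phi q) f s) - phi q (u_ (phi q) f s)).

Record radon_measure (R : realType) := RadonMeasure {
  radon_val :> {measure set (measurableTypeR R) -> \bar R} ;
  radon_neg0 : radon_val `]-oo, 0[%classic = 0%E ;
  radon_fin : forall a : R, (radon_val `[0%R, a]%classic < +oo)%E }.

Definition continuous_csupp (R : realType) (f : R -> R) : Prop :=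
  {within `[0, +oo[, continuous f} /\ exists N, forall s, N < s -> f s = 0.

Lemma mzero_radon (R : realType) (A : set (measurableTypeR R)) :
  (@mzero _ (measurableTypeR R) R A < +oo)%E.
Proof. exact: ltry. Qed.

Definition radon0 (R : realType) : radon_measure R :=
  @RadonMeasure R mzero erefl (fun a => @mzero_radon R `[0, a]%classic).

HB.instance Definition _ (R : realType) := gen_eqMixin (radon_measure R).
HB.instance Definition _ (R : realType) := gen_choiceMixin (radon_measure R).
HB.instance Definition _ (R : realType) :=
  isPointed.Build (radon_measure R) (radon0 R).
(* the vague topology *)
HB.instance Definition _ (R : realType) :=
  @isSubBaseTopological.Build (radon_measure R) ((R -> R) * set R)%type
    [set fU | continuous_csupp fU.1 /\ open fU.2]
    (fun fU => [set nu : radon_measure R |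
                 fU.2 (\int[nu]_(s in `[0, +oo[) fU.1 s)]).

Definition radonType (R : realType) :=
  g_sigma_algebraType (@open (radon_measure R)).

Record cadlag (R : realType) := Cadlag {
  cadlag_val :> R -> R ;
  cadlag_neg0 : forall s, s < 0 -> cadlag_val s = 0 ;
  cadlag_ge0 : forall s, 0 <= s -> 0 <= cadlag_val s ;
  cadlag_right : forall s, 0 <= s -> cadlag_val @ s^'+ --> cadlag_val s ;
  cadlag_left : forall s, 0 < s -> cvg (cadlag_val @ s^'-) }.

(* Continuity of the increasing bijections of [0, oo) is automatic. *)
Definition time_change (R : realType) (l : R -> R) : Prop :=
  set_bij `[0, +oo[ `[0, +oo[ l /\
  forall s t, 0 <= s -> s < t -> l s < l t.

(* w_k --> w in the Skorokhod J1 topology iff for all N and e > 0 the path w_k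
   eventually belongs to [skorokhod_ball w N e], i.e. iff there are time changes
   l_k with sup_s |l_k(s) - s| -> 0 and, for all N,
   sup_(s <= N) |w_k(l_k(s)) - w(s)| -> 0. *)
Definition skorokhod_ball (R : realType) (w : cadlag R) (N e : R) :
    set (cadlag R) :=
  [set w' | exists2 l, time_change l &
    (forall s, 0 <= s -> `|l s - s| < e) /\
    (forall s, 0 <= s <= N -> `|w' (l s) - w s| < e)].

Definition skorokhod_open (R : realType) (U : set (cadlag R)) : Prop :=
  forall w, U w -> exists N e, 0 < e /\ skorokhod_ball w N e `<=` U.

Lemma skorokhod_openT (R : realType) : skorokhod_open [set: cadlag R].
Proof. by move=> w _; exists 0, 1. Qed.

Lemma skorokhod_ballS (R : realType) (w : cadlag R) (N N' e e' : R) :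
  N <= N' -> e' <= e -> skorokhod_ball w N' e' `<=` skorokhod_ball w N e.
Proof.
move=> NN' ee' w' [l tl [l1 l2]]; exists l => //; split => s.
  by move=> /l1 /lt_le_trans; apply.
move=> /andP[s0 sN]; apply: (lt_le_trans _ ee'); apply: l2.
by rewrite s0 (le_trans sN).
Qed.

Lemma skorokhod_openI (R : realType) : setI_closed (@skorokhod_open R).
Proof.
move=> U V oU oV w [/oU[N [e [e0 NeU]]] /oV[N' [e' [e'0 NeV]]]].
exists (Num.max N N'), (Num.min e e'); split; first by rewrite lt_min e0.
move=> w' ww'; split.
- by apply: NeU; apply: skorokhod_ballS ww'; rewrite ?le_max ?ge_min lexx.
- by apply: NeV; apply: skorokhod_ballS ww'; rewrite ?le_max ?ge_min lexx orbT.
Qed.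

Lemma skorokhod_open_bigcup (R : realType) (I : Type) (f : I -> set (cadlag R)) :
  (forall i, skorokhod_open (f i)) -> skorokhod_open (\bigcup_i f i).
Proof.
move=> of_ w [i _ /of_[N [e [e0 Nef]]]]; exists N, e; split => // w' /Nef ?.
by exists i.
Qed.

Lemma cst0_cvg (R : realType) (F : set_system R) (FF : Filter F) :
  (cst 0 : R -> R) @ F --> (0 : R).
Proof. exact: cvg_cst. Qed.

Definition cadlag0 (R : realType) : cadlag R :=
  @Cadlag R (cst 0) (fun _ _ => erefl) (fun _ _ => lexx 0)
    (fun s _ => @cst0_cvg R s^'+ _)
    (fun s _ => cvgP (0 : R) (@cst0_cvg R s^'- _)).

HB.instance Definition _ (R : realType) := gen_eqMixin (cadlag R).
HB.instance Definition _ (R : realType) := gen_choiceMixin (cadlag R).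
HB.instance Definition _ (R : realType) := isPointed.Build (cadlag R) (cadlag0 R).
HB.instance Definition _ (R : realType) :=
  isOpenTopological.Build (cadlag R) (@skorokhod_openT R) (@skorokhod_openI R)
    (@skorokhod_open_bigcup R).

Definition cadlagType (R : realType) :=
  g_sigma_algebraType (@open (cadlag R)).

(* Inhomogeneous transition semigroup with time set [T] on the state space [S],
   a subset of the measurable type [E]; the kernels may be sub-Markov, and their
   values outside [S] are irrelevant. *)
Definition transition_semigroup (R : realType) (T : set R)
    d (E : measurableType d) (S : set E) (K : R -> R -> R.-spker E ~> E) : Prop :=
  [/\ forall p q x, T p -> T q -> p <= q -> S x -> K p q x (~` S) = 0%E,
      forall p x B, T p -> S x -> measurable B -> K p p x B = \d_x B &
      forall p q r x B, T p -> T q -> T r -> p <= q -> q <= r -> S x ->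
        measurable B -> K p r x B = (\int[K p q x]_(y in S) K q r y B)%E].

Definition conservative (R : realType) (T : set R)
    d (E : measurableType d) (K : R -> R -> R.-spker E ~> E) : Prop :=
  forall p q x, T p -> T q -> p <= q -> K p q x setT = 1%E.

(* restriction of [K] to [S]: transitions out of [S] lead to the cemetery *)
Definition restrict_kernel (R : realType) d (E : measurableType d) (S : set E)
    (K : R -> R -> R.-spker E ~> E) : R -> R -> E -> set E -> \bar R :=
  fun p q x B => K p q x (B `&` S).

(* A process with state space [S] and a cemetery, represented by [None]. *)

(* sigma(X_r : r in T, r <= p) *)
Definition natural_filtration (R : realType) (T : set R) d (E : measurableType d)
    (Om : Type) (X : R -> Om -> option E) (p : R) : set (set Om) :=
  <<s [set A | exists r B, [/\ T r, r <= p, measurable B &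
                              A = X r @^-1` (some @` B)]] >>.

(* The Markov property P(X_q in B | X_r, r <= p) = K_(p,q)(X_p, B), where
   K_(p,q)(cemetery, B) = 0. Testing it on the Borel sets B of [E] suffices, as
   the cemetery event is the complement of {X_q in E}. *)
Definition markov_process (R : realType) (T : set R)
    d (E : measurableType d) (S : set E) (K : R -> R -> E -> set E -> \bar R)
    d' (Om : measurableType d') (P : probability Om R)
    (X : R -> Om -> option E) : Prop :=
  [/\ forall q w x, T q -> X q w = Some x -> S x,
      forall q B, T q -> measurable B -> measurable (X q @^-1` (some @` B)) &
      forall p q B G, T p -> T q -> p <= q -> measurable B ->
        natural_filtration T X p G ->
        P (G `&` X q @^-1` (some @` B)) =
        (\int[P]_(w in G) if X p w is Some x then K p q x B else 0)%E].

Definition Q_laplace (R : realType) (T : set R) (phi : R -> R -> R) (mu : R -> R)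
    (Q : R -> R -> R.-spker (radonType R) ~> (radonType R)) : Prop :=
  forall p q (eta : radonType R) f, T p -> T q -> p <= q -> bounded_pos_csupp f ->
    (\int[Q p q eta]_nu
       (expR (- \int[radon_val nu]_(s in `[0%R, +oo[) f s)%R)%:E)%E
    = (expR (- (mu q - mu p) * u_ (phi q) f 0
             - \int[radon_val eta]_(s in `[0, +oo[) u2_ phi p q f s))%:E.

Definition P_laplace (R : realType) (T : set R) (phi : R -> R -> R) (mu : R -> R)
    (P : R -> R -> R.-spker (cadlagType R) ~> (cadlagType R)) : Prop :=
  forall p q (rho : cadlagType R) f, T p -> T q -> p <= q -> bounded_pos_csupp f ->
    (\int[P p q rho]_w
       (expR (- \int[@lebesgue_measure R]_(s in `[0%R, +oo[)
                  (f s * cadlag_val w s))%R)%:E)%E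
    = (expR (- (mu q - mu p) * u_ (phi q) f 0
             - \int[@lebesgue_measure R]_(s in `[0, +oo[)
                 (u2_ phi p q f s * cadlag_val rho s)))%:E.

Definition radon_mass (R : realType) (nu : radonType R) : \bar R :=
  radon_val nu `[0, +oo[%classic.

Definition path_mass (R : realType) (w : cadlagType R) : \bar R :=
  (\int[@lebesgue_measure R]_(s in `[0%R, +oo[) (cadlag_val w s)%:E)%E.

(* M[0, oo) and D^+_in[0, oo) *)
Definition finite_measures (R : realType) : set (radonType R) :=
  [set nu | (radon_mass nu < +oo)%E].

Definition integrable_paths (R : realType) : set (cadlagType R) :=
  [set w | (path_mass w < +oo)%E].

(* the total mass is infinite at the cemetery *)
Definition total_mass (R : realType) (E : Type) (mass : E -> \bar R)
    (z : option E) : \bar R :=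
  if z is Some x then mass x else +oo%E.

(* an element of [0, +oo] as a point of R_+ or, for +oo, as the cemetery *)
Definition Rplus_state (R : realType) (y : \bar R) : option (measurableTypeR R) :=
  if y is r%:E then Some r else None.

(* Main.v *)
(* Take lambda > 0 and c = phi_q^{-1}(lambda), so that phi_q(c) = lambda. A path u
   that equals c up to time n and then decreases linearly to 0, steeply enough,
   is the solution u_q(., f) for the compactly supported positive function
   f = phi_q(u) - u', which equals lambda up to time n; there u_{p,q}(., f)
   equals phi_p(c). Letting n -> oo in the Laplace functionals gives
     E[exp(- lambda mass(Z_q)) | Z_p = x] = exp(- mu(p,q] c - phi_p(c) mass(x)),
   with exp(-oo) = 0. The conditional law of the finite part of the mass thus
   depends on x through mass(x) only, and it is the same for the measure-valued
   and the path-valued semigroups, since a finite measure on [0, oo) is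
   determined by its Laplace transform. For R_{p,q}(x, .) one takes this law for
   the initial state x delta_0; its Chapman-Kolmogorov equation and the Markov
   property of the mass process are those of Q and P. *)
From HB Require Import structures.
From mathcomp Require Import finmap.
Require Import Defs.
From mathcomp Require Import all_boot all_order all_algebra.
From mathcomp Require Import all_classical all_reals all_analysis.
From mathcomp Require Import measurable_realfun ring lra.

Set Implicit Arguments.
Unset Strict Implicit.
Unset Printing Implicit Defensive.

Import Order.TTheory GRing.Theory Num.Theory.
Import numFieldNormedType.Exports.

Local Open Scope classical_set_scope.
Local Open Scope ring_scope.

(** * Branching mechanisms and their inverses *)

(** The backward equation has no explicit solution for a given [f], and a nonzero constant is
    excluded by compact support; prescribing the solution and reading off [f] avoids both
    difficulties. What shapes the rest: [phi q] may be negative near 0, which bounds the slope of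
    the descent from below; the resulting [f] has jumps, so its integral is not a vaguely continuous
    functional and needs its own measurability proof; on path space the functionals are only lower
    semicontinuous for the Skorokhod topology; infinite masses must be followed through every limit,
    which is why the transform is first taken at lambda > 0. The value at lambda = 0 is a separate
    limit, since [phi_inv (phi q) 0] may be positive and the mass may then become infinite with
    positive probability. Finally, [x delta_0] is a measure but not a path, so the one semigroup of
    the mass is built from [Q] and the laws under [P] are compared with it. *)

Section phi.
Context (R : realType).
Implicit Types (x y z C : R).

(** The derivative 1 - e^{-x} increases and is at most min(1, x). The bounds [e1] and [e2], both
    from 1 + t <= e^t, replace the mean value theorem. *)
Lemma compensated_expR_lip x y : 0 <= y <= x ->
  `|(expR (- x) - 1 + x) - (expR (- y) - 1 + y)| <= (x - y) * Num.min 1 x.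
Proof.
move=> /andP[y0 yx].
have e1 : expR (- y) - expR (- x) <= x - y.
  have -> : expR (- x) = expR (- y) * expR (- (x - y)).
    by rewrite -expRD; congr expR; lra.
  have h1 := @expR_ge1Dx R (- (x - y)).
  have h2 : expR (- y) <= 1 by rewrite -[1](expR0 R) ler_expR; lra.
  have h3 := expR_gt0 (- y).
  nra.
have e2 : expR (- x) * (x - y) <= expR (- y) - expR (- x).
  have -> : expR (- y) = expR (- x) * expR (x - y).
    by rewrite -expRD; congr expR; lra.
  have h1 := @expR_ge1Dx R (x - y).
  have h3 := expR_gt0 (- x).
  nra.
rewrite ger0_norm; last by lra.
have h1 := @expR_ge1Dx R (- x).
have h3 := expR_gt0 (- x).
by rewrite minEle; case: ifP => _; nra.
Qed.

(** The factor z min(1, z C) is at most C min(z, z^2) because C >= 1; this produces the weight that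
    [m] integrates. *)
Lemma compensated_expR_scaled_lip z C x y : 0 < z -> 1 <= C ->
  0 <= x <= C -> 0 <= y <= C ->
  `|(expR (- (z * x)) - 1 + z * x) - (expR (- (z * y)) - 1 + z * y)| <=
  `|x - y| * C * Num.min z (z ^+ 2).
Proof.
move=> z0 C1; wlog yx : x y / y <= x => [H xC yC|/andP[x0 xC] /andP[y0 yC]].
  have [yx|/ltW xy] := leP y x; first exact: H.
  by rewrite distrC (distrC x); exact: H.
apply: (le_trans (compensated_expR_lip _)).
  by rewrite mulr_ge0 ?(ltW z0)//= ler_wpM2l// ltW.
rewrite (ger0_norm (_ : 0 <= x - y)) ?subr_ge0// -mulrBr -mulrA (mulrC z) -mulrA.
rewrite ler_wpM2l ?subr_ge0// !minr_pMr ?(ltW z0) ?(le_trans ler01 C1)//.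
rewrite mulr1 le_min !ge_min expr2.
apply/andP; split; apply/orP; [left|right]; first by nra.
by have zz := mulr_ge0 (ltW z0) (ltW z0); nra.
Qed.

Variables (b sigma : R) (m : {measure set (measurableTypeR R) -> \bar R}).
Hypothesis hm : branching_params sigma m.

Let I := (`]0, +oo[%classic : set (measurableTypeR R)).

Let mI : measurable I. Proof. exact: measurable_itv. Qed.

Lemma min_sqr_integrable :
  m.-integrable I (EFin \o (fun z : R => Num.min z (z ^+ 2))).
Proof.
apply/integrableP; split.
  apply/measurable_EFinP; apply: measurable_minr => //.
case: hm => _; apply: le_lt_trans.
rewrite le_eqVlt; apply/orP; left; apply/eqP; apply: eq_integral => z.
rewrite inE /I/= in_itv/= andbT => z0.
by rewrite /= ger0_norm// le_min (ltW z0) exprn_ge0// ltW.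
Qed.

Lemma compensated_expR_integrable x : 0 <= x ->
  m.-integrable I (EFin \o (fun z : R => expR (- (z * x)) - 1 + z * x)).
Proof.
move=> x0.
have := @integrableZl _ _ _ m I mI (x * (x + 1)) _ min_sqr_integrable.
apply: le_integrable => //.
  apply/measurable_EFinP; apply: measurable_funD; last exact: measurable_funM.
  apply: measurable_funB => //; apply: measurableT_comp => //.
  by apply: measurable_funN; exact: measurable_funM.
move=> z; rewrite /I/= in_itv/= andbT => z0.
have := @compensated_expR_scaled_lip z (x + 1) x 0 z0.
rewrite !mulr0 oppr0 expR0 subrr !addr0 ?oppr0 ?addr0 (ger0_norm x0) lexx x0/=.
rewrite lerDr lerDl x0 ler01 addr_ge0//= => /(_ isT isT isT) h.
rewrite lee_fin (le_trans h)// normrM ler_pM ?ler_norm ?mulr_ge0 ?addr_ge0//.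
by rewrite le_min (ltW z0) exprn_ge0// ltW.
Qed.

Lemma branching_mechanism0 : branching_mechanism b sigma m 0 = 0.
Proof.
rewrite /branching_mechanism mulr0 expr0n/= mulr0 !add0r.
rewrite (@eq_Rintegral _ _ _ _ _ (cst 0)).
  by rewrite Rintegral_cst// mul0r.
by move=> z _; rewrite /= mulr0 oppr0 expR0 subrr addr0.
Qed.

(** The later sections use the branching form through this bound and [branching_mechanism0]. The
    quadratic term makes the constant depend on [C]. *)
Lemma branching_mechanism_lip C : exists2 L, 0 <= L &
  forall x y, 0 <= x <= C -> 0 <= y <= C ->
   `|branching_mechanism b sigma m x - branching_mechanism b sigma m y| <=
   L * `|x - y|.
Proof.
pose D := Num.max 1 C.
have D1 : 1 <= D by rewrite le_max lexx.
pose J := \int[m]_(z in I) Num.min z (z ^+ 2).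
have J0 : 0 <= J.
  apply: Rintegral_ge0 => z; rewrite /I/= in_itv/= andbT => z0.
  by rewrite le_min (ltW z0) exprn_ge0// ltW.
exists (`|b| + sigma ^+ 2 * D + D * J).
  by rewrite !addr_ge0// mulr_ge0 ?sqr_ge0// (le_trans ler01).
move=> x y xC yC.
have xD : 0 <= x <= D.
  by case/andP: xC => x0 xC; rewrite x0 le_max xC orbT.
have yD : 0 <= y <= D.
  by case/andP: yC => y0 yC; rewrite y0 le_max yC orbT.
have x0 : 0 <= x by case/andP: xD.
have y0 : 0 <= y by case/andP: yD.
rewrite /branching_mechanism -/I.
set Jx := Rintegral _ _ _; set Jy := Rintegral _ _ _.
have iB := integrableB mI (compensated_expR_integrable x0) (compensated_expR_integrable y0).
have HJ : `|Jx - Jy| <= `|x - y| * D * J.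
  rewrite /Jx /Jy -RintegralB//; try exact: compensated_expR_integrable.
  apply: (le_trans (le_normr_Rintegral mI iB)).
  rewrite /J -RintegralZl//; last exact: min_sqr_integrable.
  apply: le_Rintegral => //.
  - exact: (integrable_norm iB).
  - exact: (integrableZl mI _ min_sqr_integrable).
  - move=> z; rewrite /I/= in_itv/= andbT => z0.
    exact: compensated_expR_scaled_lip.
have -> : b * x + 2^-1 * sigma ^+ 2 * x ^+ 2 + Jx
   - (b * y + 2^-1 * sigma ^+ 2 * y ^+ 2 + Jy) =
   (b + 2^-1 * sigma ^+ 2 * (x + y)) * (x - y) + (Jx - Jy) by field.
apply: (le_trans (ler_normD _ _)).
rewrite [leRHS](_ : _ = (`|b| + sigma ^+ 2 * D) * `|x - y| + `|x - y| * D * J); last by ring.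
rewrite lerD//.
rewrite normrM ler_wpM2r//.
apply: (le_trans (ler_normD _ _)); rewrite lerD2l.
have s0 := sqr_ge0 sigma; set s := sigma ^+ 2 in s0 *.
case/andP: xD => _ xD; case/andP: yD => _ yD.
have xyD : 0 <= D - 2^-1 * (x + y) by lra.
have xy0 : 0 <= 2^-1 * (x + y) by lra.
rewrite (_ : 2^-1 * s * (x + y) = s * (2^-1 * (x + y))); last by ring.
rewrite ger0_norm; last exact: mulr_ge0.
by rewrite ler_wpM2l// -subr_ge0.
Qed.

End phi.

(** Restricted to [0, C] because nothing is known of a mechanism at negative arguments. *)
Definition locally_lipschitz (R : realType) (phi : R -> R) : Prop :=
  forall C, exists2 L, 0 <= L & forall x y, 0 <= x <= C -> 0 <= y <= C ->
    `|phi x - phi y| <= L * `|x - y|.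

Section phi_inv.
Context (R : realType) (phi : R -> R).
Hypotheses (phi_lip : locally_lipschitz phi) (phi0 : phi 0 = 0)
  (phi_oo : phi lam @[lam --> +oo] --> +oo).

Let S lam := [set z | 0 <= z /\ lam < phi z].

Let S_lb lam : lbound (S lam) 0. Proof. by move=> z []. Qed.

Let S_inf lam : has_inf (S lam).
Proof.
split; last by exists 0.
have [M [_ HM]] := (cvgryPgt _).1 phi_oo lam.
have /HM h : M < Num.max M 0 + 1 by rewrite ltr_pwDr// le_max lexx.
by exists (Num.max M 0 + 1); split => //; rewrite addr_ge0// le_max lexx orbT.
Qed.

Lemma phi_inv_ge0 lam : 0 <= phi_inv phi lam.
Proof. by apply: lb_le_inf; [case: (S_inf lam)|exact: S_lb]. Qed.

(** Both strict inequalities contradict the infimum, made quantitative by the Lipschitz constant on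
    [0, c + 1]: if phi(c) > lam, then c > 0 and phi(c - d) > lam; if phi(c) < lam, then phi stays at
    most lam on [c, c + e). *)
Lemma phi_invK lam : 0 <= lam -> phi (phi_inv phi lam) = lam.
Proof.
move=> lam0; set c := phi_inv phi lam.
have c0 : 0 <= c := phi_inv_ge0 lam.
have [L L0 HL] := phi_lip (c + 1).
apply/eqP; rewrite eq_le; apply/andP; split; rewrite leNgt; apply/negP => h.
- have cpos : 0 < c.
    by rewrite lt_neqAle c0 andbT; apply: contraTneq h => <-; rewrite phi0 -leNgt.
  pose d := Num.min c ((phi c - lam) / (L + 1)).
  have L1 : 0 < L + 1 by rewrite ltr_wpDl.
  have d0 : 0 < d by rewrite lt_min cpos divr_gt0// subr_gt0.
  have dc : d <= c by rewrite ge_min lexx.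
  have Ld : (L + 1) * d <= phi c - lam.
    by rewrite mulrC -ler_pdivlMr// ge_min lexx orbT.
  have /HL : 0 <= c - d <= c + 1 by lra.
  have cc : 0 <= c <= c + 1 by lra.
  move=> /(_ c cc); rewrite [X in _ * `|X|](_ : _ = - d); last by ring.
  rewrite normrN (gtr0_norm d0) ler_norml => /andP[H _].
  have : c <= c - d.
    by apply: ge_inf; [exists 0; exact: S_lb|split => /=; lra].
  by lra.
- have L1 : 0 < L + 1 by rewrite ltr_wpDl.
  pose e := Num.min 1 ((lam - phi c) / (L + 1)).
  have e0 : 0 < e by rewrite lt_min ltr01 divr_gt0// subr_gt0.
  have Le : (L + 1) * e <= lam - phi c.
    by rewrite mulrC -ler_pdivlMr// ge_min lexx orbT.
  have e1 : e <= 1 by rewrite ge_min lexx.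
  have [z [z0 zlam] zce] := inf_adherent e0 (S_inf lam).
  have cz : c <= z by apply: ge_inf; [exists 0; exact: S_lb|].
  rewrite -/(phi_inv phi lam) -/c in zce.
  have zc1 : 0 <= z <= c + 1 by lra.
  have cc : 0 <= c <= c + 1 by lra.
  have := HL z c zc1 cc.
  rewrite (ger0_norm (_ : 0 <= z - c)) ?subr_ge0// ler_norml => /andP[_ H].
  nra.
Qed.

Lemma phi_inv_gt0 lam : 0 < lam -> 0 < phi_inv phi lam.
Proof.
move=> lam0; rewrite lt_neqAle phi_inv_ge0 andbT; apply/eqP => h.
by have := phi_invK (ltW lam0); rewrite -h phi0 => lam0'; rewrite -lam0' ltxx in lam0.
Qed.

Lemma phi_inv_homo l1 l2 : l1 <= l2 -> phi_inv phi l1 <= phi_inv phi l2.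
Proof.
move=> l12; apply: le_inf; [|by case: (S_inf l2)|exact: S_inf].
move=> x [y [y0 yl] <-].
by exists (- y); split => //; exists y => //; split => //; exact: le_lt_trans yl.
Qed.

(** Right continuity comes from the strict inequality in [phi_inv]: a point z with phi(z) > 0 also
    satisfies phi(z) > lambda for all small lambda. It carries the Laplace formula to lambda = 0. *)
Lemma cvg_phi_inv0 : phi_inv phi (k.+1%:R^-1) @[k --> \oo] --> phi_inv phi 0.
Proof.
apply/cvgrPdist_lt => e e0.
have [z [z0 zl] zce] := inf_adherent e0 (S_inf 0).
near=> k.
have h : phi_inv phi 0 <= phi_inv phi (k.+1%:R^-1).
  by apply: phi_inv_homo; rewrite invr_ge0.
rewrite ler0_norm ?subr_le0// opprB ltrBlDl.
apply: le_lt_trans zce; apply: ge_inf; first by exists 0; exact: S_lb.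
split => //; near: k; exact: near_infty_natSinv_lt (PosNum zl).
Unshelve. all: by end_near. Qed.

End phi_inv.

(** * The backward equation *)

Section halfline.
Context (R : realType).
Local Notation mR := (measurableTypeR R).

Lemma csupp_integrable (m : {measure set mR -> \bar R}) (D : set mR) (g : R -> R)
    (C N : R) : measurable D -> D `<=` `[0, +oo[ ->
  measurable_fun D (g : mR -> mR) ->
  (forall t, D t -> t <= N -> `|g t| <= C) -> (forall t, D t -> N < t -> g t = 0) ->
  (m `[0%R, N]%classic < +oo)%E -> m.-integrable D (EFin \o g).
Proof.
move=> mD D0 mg gC gN mN.
pose E := (`[0, N]%classic : set mR).
have mE : measurable E by exact: measurable_itv.
have mDE : measurable (D `&` E) by exact: measurableI.
have iDE : m.-integrable (D `&` E) (EFin \o g).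
  apply: measurable_bounded_integrable => //.
  - by apply: le_lt_trans mN; apply: le_measure; rewrite ?inE.
  - by apply: measurable_funS mg => // x [].
  - exists C; split; first exact: num_real.
    move=> x Cx t [Dt]; rewrite /E/= in_itv/= => /andP[_ tN].
    by rewrite (le_trans _ (ltW Cx))// gC.
have := (integrable_restrict m mE mD (EFin \o g)).1 iDE.
apply: eq_integrable => // t; rewrite inE => Dt; rewrite patchE.
case: ifPn => //; rewrite notin_setE /E/= in_itv/= => /negP.
have := D0 _ Dt; rewrite /= in_itv/= andbT => -> /=; rewrite -ltNge => /(gN _ Dt).
by move=> ->.
Qed.

End halfline.

Section backward_equation.
Context (R : realType) (phi : R -> R).
Hypotheses (phi_lip : locally_lipschitz phi) (phi0 : phi 0 = 0).
Local Notation mR := (measurableTypeR R).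
Local Notation H := (`[0, +oo[%classic : set mR).

(* [phi] is only controlled on [0, oo); extending it by [phi 0] makes it continuous. *)
Lemma continuous_phi_max : continuous ((fun x : R => phi (Num.max 0 x)) : R -> R).
Proof.
move=> x; apply/cvgrPdist_lt => e e0.
have [L L0 HL] := phi_lip (`|x| + 1).
have L1 : 0 < L + 1 by rewrite ltr_wpDl.
near=> y.
have xy1 : `|x - y| < 1 by near: y; exact: cvgr_dist_lt.
have xye : `|x - y| < e / (L + 1) by near: y; apply: cvgr_dist_lt => //; exact: divr_gt0.
have b t : `|x - t| < 1 -> 0 <= Num.max 0 t <= `|x| + 1.
  rewrite le_max lexx ge_max addr_ge0//= => h.
  by have := ler_norm x; have := ler_norm (t - x); rewrite distrC => *; lra.
have h : `|Num.max 0 x - Num.max 0 y| <= `|x - y|.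
  have := ler_norm (x - y); have := ler_norm (y - x); rewrite (distrC y) => h1 h2.
  have hh := normr_ge0 (x - y).
  by rewrite ler_norml !maxEle; case: ifP => ?; case: ifP => ?; lra.
apply: (le_lt_trans (HL _ _ (b x _) (b y _))) => //; first by rewrite subrr normr0.
have : (L + 1) * `|x - y| < e by rewrite mulrC -ltr_pdivlMr.
have := normr_ge0 (x - y); nra.
Unshelve. all: by end_near. Qed.

Lemma measurable_phi_comp d (T : measurableType d) (D : set T) (u : T -> R) :
  measurable D ->
  measurable_fun D (u : T -> mR) -> (forall t, D t -> 0 <= u t) ->
  measurable_fun D (phi \o u : T -> mR).
Proof.
move=> mD mu u0.
have h := measurableT_comp (continuous_measurable_fun continuous_phi_max) mu.
apply: (eq_measurable_fun _ _ h) => t; rewrite inE => Dt /=.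
by rewrite max_r// u0.
Qed.

Let leb := @lebesgue_measure R.

Lemma lebesgue_itv0_fin (N : R) : (leb `[0%R, N]%classic < +oo)%E.
Proof. by rewrite /leb lebesgue_measure_itv/=; case: ifP => _; rewrite ltry. Qed.

Lemma phi_csupp_integrable u s : 0 <= s -> bounded_pos_csupp u ->
  leb.-integrable `]s, +oo[ (EFin \o (phi \o u)).
Proof.
move=> s0 [mu u0 [C uC] [N uN]].
have sH : `]s, +oo[%classic `<=` H.
  by move=> t; rewrite /= !in_itv/= !andbT => /ltW; exact: le_trans.
have C0 : 0 <= C by apply: (le_trans (u0 0 (lexx _))); exact: uC.
have [L L0 HL] := phi_lip C.
apply: (@csupp_integrable _ _ _ _ (L * C) N) => //.
- apply: measurable_phi_comp => //; first exact: measurable_funS mu.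
  by move=> t /sH; rewrite /= in_itv/= andbT; exact: u0.
- move=> t /sH; rewrite /= in_itv/= andbT => t0 _.
  have := HL (u t) 0; rewrite phi0 !subr0 lexx C0 u0// uC// => /(_ isT isT).
  move=> /le_trans; apply; rewrite ler_wpM2l// ger0_norm ?u0// uC//.
- by move=> t _ /uN h; rewrite /= h.
- exact: lebesgue_itv0_fin.
Qed.

(** Backward Picard iteration from the right end of the supports: once the solutions agree beyond r,
    they agree beyond r - h, with a step h that depends only on a common Lipschitz constant. *)
Lemma backward_solution_unique f u v :
  backward_solution phi f u -> backward_solution phi f v ->
  forall s, 0 <= s -> u s = v s.
Proof.
move=> [bu eu] [bv ev].
have [mu u0 [Cu uC] [Nu uN]] := bu.
have [mv v0 [Cv vC] [Nv vN]] := bv.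
pose C := Num.max Cu Cv; pose N := Num.max Nu Nv.
have uC' t : 0 <= t -> 0 <= u t <= C by move=> t0; rewrite u0//= le_max uC.
have vC' t : 0 <= t -> 0 <= v t <= C by move=> t0; rewrite v0//= le_max vC// orbT.
have [L L0 HL] := phi_lip C.
(* Chosen so that [(L + 1) * h] is 1/2: integrating the difference over a length h halves any bound
   on it. *)
pose h := (2 * (L + 1))^-1.
have h0 : 0 < h by rewrite invr_gt0 mulr_gt0// ltr_wpDl.
pose w t := `|u t - v t|.
have wN t : N < t -> w t = 0.
  by rewrite gt_max => /andP[t1 t2]; rewrite /w uN// vN// subrr normr0.
have step M r : 0 <= M -> (forall t, 0 <= t -> r < t -> w t = 0) ->
    (forall t, 0 <= t -> r - h < t -> w t <= M) ->
    (forall t, 0 <= t -> r - h < t -> w t <= M / 2).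
  move=> M0 wr wM s s0 rs.
  have iu := phi_csupp_integrable s0 bu; have iv := phi_csupp_integrable s0 bv.
  have mI : measurable (`]s, +oo[%classic : set mR) by exact: measurable_itv.
  have -> : w s = `|\int[leb]_(t in `]s, +oo[) (phi (v t) - phi (u t))|.
    rewrite RintegralB//; congr (`| _ |).
    have := eu s s0; have := ev s s0; rewrite -/leb => h1 h2.
    by apply/eqP; rewrite -subr_eq0; apply/eqP; lra.
  have iB := integrableB mI iv iu.
  apply: (le_trans (le_normr_Rintegral mI iB)).
  have iI : leb.-integrable `]s, +oo[
      (EFin \o (fun t => L * M * \1_(`]s, s + h]%classic : set mR) t)).
    apply: (@csupp_integrable _ _ _ _ (L * M) (s + h)) => //.
    - by move=> t; rewrite /= !in_itv/= !andbT => /ltW; exact: le_trans.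
    - by apply: measurable_funM => //; apply: measurable_indic; exact: measurable_itv.
    - move=> t _ _; rewrite ger0_norm ?mulr_ge0//= ?indicE//.
      by rewrite ler_piMr ?mulr_ge0//; case: (_ \in _).
    - move=> t _ st; rewrite indicE (_ : _ \in _ = false) ?mulr0//.
      apply/negbTE; rewrite notin_setE/= in_itv/= => /andP[_].
      by rewrite leNgt st.
    - exact: lebesgue_itv0_fin.
  apply: (@le_trans _ _ (\int[leb]_(t in `]s, +oo[) (L * M * \1_(`]s, s + h]%classic : set mR) t))).
    apply: le_Rintegral => //; first exact: (integrable_norm iB).
    move=> t; rewrite /= in_itv/= andbT => st.
    have t0 : 0 <= t := le_trans s0 (ltW st).
    have E1 : `|phi (v t) - phi (u t)| <= L * w t.
      by rewrite distrC; apply: HL; [exact: uC'|exact: vC'].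
    apply: (le_trans E1); rewrite indicE.
    case: (ltP r t) => rt; first by rewrite wr// mulr0 !mulr_ge0.
    rewrite mem_set ?mulr1; last by rewrite /= in_itv/= st/=; lra.
    by rewrite ler_wpM2l// wM//; lra.
  rewrite RintegralZl//; last first.
    apply: (@csupp_integrable _ _ _ _ 1 (s + h)) => //.
    - by move=> t; rewrite /= !in_itv/= !andbT => /ltW; exact: le_trans.
    - by move=> t _ _; rewrite indicE; case: (_ \in _); rewrite ?normr1 ?normr0.
    - move=> t _ st; rewrite indicE (_ : _ \in _ = false)//.
      apply/negbTE; rewrite notin_setE/= in_itv/= => /andP[_].
      by rewrite leNgt st.
    - exact: lebesgue_itv0_fin.
  rewrite /Rintegral integral_indic//.
  rewrite (_ : _ `&` _ = `]s, s + h]%classic); last first.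
    apply/seteqP; split=> [t []|t] //=; rewrite !in_itv/= => /andP[st ->].
    by rewrite st.
  have lh : lebesgue_measure (`]s, s + h]%classic : set R) = h%:E.
    by rewrite lebesgue_measure_itv/= lte_fin ltrDl h0/= -EFinB addrC addKr.
  rewrite [X in _ * _ * X](_ : _ = h); last exact: (congr1 fine lh).
  rewrite (_ : M / 2 = (L + 1) * M * h); last by rewrite /h; field; lra.
  by rewrite ler_wpM2r ?(ltW h0)// ler_wpM2r//; lra.
have all k : forall t, 0 <= t -> N - k%:R * h < t -> w t = 0.
  elim: k => [t t0|k IH t t0]; first by rewrite mul0r subr0; exact: wN.
  rewrite -natr1 mulrDl mul1r opprD addrA => kt.
  have C0 : 0 <= C by have /andP[] := uC' 0 (lexx _); exact: le_trans.
  (* Both solutions take values in [0, C], so C is a first bound; halving it repeatedly leaves only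
     0. *)
  have bnd n : forall t, 0 <= t -> N - k%:R * h - h < t -> w t <= C * 2^-1 ^+ n.
    elim: n => [r r0 _|n IHn].
      rewrite expr0 mulr1 /w ler_norml.
      by have := uC' _ r0; have := vC' _ r0; lra.
    rewrite exprSr mulrA; apply: step => //.
    by rewrite mulr_ge0// exprn_ge0.
  apply/eqP; rewrite eq_le normr_ge0 andbT.
  have h1 : (fun _ : nat => w t) @ \oo --> w t by exact: cvg_cst.
  have h2 : (fun n => C * 2^-1 ^+ n) @ \oo --> (0 : R).
    rewrite -[X in _ --> X](mulr0 C); apply: cvgMr; apply: cvg_expr.
    by rewrite ger0_norm// invf_lt1// ltr1n.
  by apply: (ler_cvg_to h1 h2); apply: nearW => n; exact: bnd.
move=> s s0; apply/eqP; rewrite -subr_eq0 -normr_eq0; apply/eqP.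
have [k Nk] : exists k : nat, N - s < k%:R * h.
  have [k hk] : exists k : nat, (N - s) / h < k%:R.
    by exists (Num.truncn `|(N - s) / h|).+1; rewrite (le_lt_trans (ler_norm _))// truncnS_gt.
  by exists k; rewrite -ltr_pdivrMr.
by apply: (all k) => //; lra.
Qed.

End backward_equation.

(** * Ramps as explicit solutions of the backward equation *)

Section ramp.
Context (R : realType).
Local Notation mR := (measurableTypeR R).
Local Notation H := (`[0, +oo[%classic : set mR).

Definition ramp (c k : R) (n : nat) (s : R) : R :=
  Num.max 0 (Num.min c (c - k * (s - n%:R))).

(* This is phi(u) - u' for u = [ramp c k n]. *)
Definition ramp_source (phi : R -> R) (c k : R) (n : nat) (s : R) : R :=
  phi (ramp c k n s) + k * \1_(`]n%:R, n%:R + c / k[%classic : set mR) s.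

Section props.
Variables (phi : R -> R) (c k : R).
Hypotheses (phi_lip : locally_lipschitz phi) (phi0 : phi 0 = 0).
Hypotheses (c0 : 0 < c) (k0 : 0 < k).
Let kc : k * (c / k) = c. Proof. by rewrite mulrC divfK// gt_eqF. Qed.

Lemma ramp_ge0 n s : 0 <= ramp c k n s.
Proof. by rewrite /ramp le_max lexx. Qed.

Lemma ramp_le n s : ramp c k n s <= c.
Proof. by rewrite /ramp ge_max (ltW c0)/= ge_min lexx. Qed.

Lemma ramp_before n s : s <= n%:R -> ramp c k n s = c.
Proof.
move=> sn; rewrite /ramp min_l; first by rewrite max_r// ltW.
by rewrite lerDl oppr_ge0 pmulr_rle0// subr_le0.
Qed.

Lemma ramp_after n s : n%:R + c / k <= s -> ramp c k n s = 0.
Proof.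
move=> ns; rewrite /ramp max_l// ge_min; apply/orP; right.
rewrite -[X in X - _]kc -mulrBr pmulr_rle0//; lra.
Qed.

Lemma continuous_ramp n : continuous (ramp c k n).
Proof.
move=> s.
have h0 : {for s, continuous (fun t : R => c - k * (t - n%:R) : R^o)}.
  apply: cvgB; first exact: cvg_cst.
  by apply: cvgMr; apply: cvgB; [exact: cvg_id|exact: cvg_cst].
have h1 : {for s, continuous (fun t : R => c : R^o)} by exact: cvg_cst.
have h2 : {for s, continuous (fun t : R => 0 : R^o)} by exact: cvg_cst.
exact: (continuous_max h2 (continuous_min h1 h0)).
Qed.

Lemma ramp_source_before n s : s <= n%:R -> ramp_source phi c k n s = phi c.
Proof.
move=> sn; rewrite /ramp_source ramp_before// indicE (_ : _ \in _ = false) ?mulr0 ?addr0//.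
by apply/negbTE; rewrite notin_setE/= in_itv/= => /andP[]; rewrite ltNge sn.
Qed.

Lemma ramp_source_after n s : n%:R + c / k < s -> ramp_source phi c k n s = 0.
Proof.
move=> sn; rewrite /ramp_source ramp_after ?(ltW sn)// phi0 add0r indicE.
rewrite (_ : _ \in _ = false) ?mulr0//.
by apply/negbTE; rewrite notin_setE/= in_itv/= => /andP[_]; rewrite ltNge (ltW sn).
Qed.

(** On the descent the source is [phi u + k], so [k] has to absorb the negative values that a
    supercritical mechanism takes on [0, c]. *)
Lemma ramp_source_ge0 n s : 0 <= phi c ->
  (forall x, 0 <= x <= c -> - k <= phi x) -> 0 <= ramp_source phi c k n s.
Proof.
move=> phic phik; rewrite /ramp_source.
have [sn|sn] := leP s n%:R.
  by rewrite ramp_before// addr_ge0// mulr_ge0 ?(ltW k0)// indicE; case: (_ \in _).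
have [ns|ns] := leP (n%:R + c / k) s.
  by rewrite ramp_after// phi0 add0r mulr_ge0 ?(ltW k0)// indicE; case: (_ \in _).
rewrite indicE mem_set ?mulr1; last by rewrite /= in_itv/= sn.
by have := phik (ramp c k n s); rewrite ramp_ge0 ramp_le => /(_ isT); lra.
Qed.

Lemma ramp_source_bounded : exists C, forall n s, `|ramp_source phi c k n s| <= C.
Proof.
have [L L0 HL] := phi_lip c.
exists (L * c + k) => n s; rewrite /ramp_source (le_trans (ler_normD _ _))// lerD//.
  have := HL (ramp c k n s) 0; rewrite phi0 !subr0 ramp_ge0 ramp_le lexx (ltW c0)/=.
  move=> /(_ isT isT) h; apply: (le_trans h); rewrite ler_wpM2l//.
  by rewrite ger0_norm ?ramp_ge0// ramp_le.
rewrite indicE; case: (_ \in _); rewrite ?mulr1 ?mulr0 ?normr0 ?(ltW k0)//.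
by rewrite gtr0_norm.
Qed.

Lemma measurable_ramp_source n (D : set mR) : measurable D ->
  measurable_fun D (ramp_source phi c k n : mR -> mR).
Proof.
move=> mD; apply: measurable_funD.
  apply: measurable_phi_comp => //; last by move=> t _; exact: ramp_ge0.
  by apply: measurable_funTS; apply: continuous_measurable_fun; exact: continuous_ramp.
by apply: measurable_funM.
Qed.

Lemma ramp_bounded_pos_csupp n : bounded_pos_csupp (ramp c k n).
Proof.
split.
- by apply: measurable_funTS; apply: continuous_measurable_fun; exact: continuous_ramp.
- by move=> s _; exact: ramp_ge0.
- by exists c => s _; exact: ramp_le.
- by exists (n%:R + c / k) => s /ltW; exact: ramp_after.
Qed.

Lemma ramp_source_bounded_pos_csupp n : 0 <= phi c ->
  (forall x, 0 <= x <= c -> - k <= phi x) -> bounded_pos_csupp (ramp_source phi c k n).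
Proof.
move=> phic phik; split.
- exact: measurable_ramp_source.
- by move=> s _; exact: ramp_source_ge0.
- have [C HC] := ramp_source_bounded.
  by exists C => s _; rewrite (le_trans (ler_norm _)).
- by exists (n%:R + c / k) => s; exact: ramp_source_after.
Qed.

(** The terms in [phi] cancel; what remains is that [ramp] is the tail integral of [k] times the
    indicator of the descent interval, a computation of lengths. *)
Lemma backward_solution_ramp n : backward_solution phi (ramp_source phi c k n) (ramp c k n).
Proof.
split; first exact: ramp_bounded_pos_csupp.
move=> s s0.
have mI : measurable (`]s, +oo[%classic : set mR) by exact: measurable_itv.
pose J := (`]n%:R, n%:R + c / k[%classic : set mR).
have mJ : measurable J by exact: measurable_itv.
have iJ : (@lebesgue_measure R).-integrable `]s, +oo[ (EFin \o (\1_J : mR -> R)).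
  apply: (@csupp_integrable _ _ _ _ 1 (n%:R + c / k)) => //.
  - by move=> t; rewrite /= !in_itv/= !andbT => /ltW; exact: le_trans.
  - by move=> t _ _; rewrite indicE; case: (_ \in _); rewrite ?normr1 ?normr0.
  - move=> t _ st; rewrite indicE (_ : _ \in _ = false)//.
    apply/negbTE; rewrite notin_setE/J/= in_itv/= => /andP[_].
    by rewrite ltNge (ltW st).
  - exact: lebesgue_itv0_fin.
rewrite /ramp_source RintegralD//; last 2 first.
- exact: (phi_csupp_integrable phi_lip phi0 s0 (ramp_bounded_pos_csupp n)).
- exact: (integrableZl mI _ iJ).
rewrite RintegralZl// addrC; congr (_ + _).
rewrite [X in _ * X](_ : _ = fine (lebesgue_measure (J `&` `]s, +oo[%classic : set R)));
  last by congr fine; exact: integral_indic.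
have -> : (J `&` `]s, +oo[%classic : set R) = `](Num.max n%:R s), (n%:R + c / k)[%classic.
  apply/seteqP; split=> t; rewrite /J/= !in_itv/= !andbT gt_max.
    by move=> [/andP[-> ->] ->].
  by move=> /andP[/andP[-> ->] ->].
rewrite lebesgue_measure_itv/= lte_fin gt_max ltrDl divr_gt0//=.
have [ns|ns] := ltP s (n%:R + c / k); last by rewrite ramp_after// mulr0.
rewrite -EFinB/= mulrBr mulrDr kc /ramp.
have kx : c - k * (s - n%:R) = k * (c / k + n%:R - s) by rewrite -[X in X - _ = _]kc; ring.
rewrite (@max_r _ _ 0); last first.
  by rewrite le_min (ltW c0)/= kx mulr_ge0 ?(ltW k0)//; lra.
have [sn|sn] := leP n%:R s.
  by rewrite min_r; [ring|rewrite gerBl mulr_ge0 ?(ltW k0)// subr_ge0].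
by rewrite min_l; [ring|rewrite lerDl oppr_ge0 pmulr_rle0// subr_le0 ltW].
Qed.

Lemma u_ramp_source n s : 0 <= s -> u_ phi (ramp_source phi c k n) s = ramp c k n s.
Proof.
apply: (backward_solution_unique phi_lip phi0 (f := ramp_source phi c k n)).
  have := @xgetPex _ (cst 0) [set u | backward_solution phi (ramp_source phi c k n) u].
  by apply; exists (ramp c k n); exact: backward_solution_ramp.
exact: backward_solution_ramp.
Qed.

End props.

(** Adding [phi p - phi q] along the solution merely exchanges the mechanism in the source. Both
    sides of the Laplace identity then have the same shape, and one limit theorem serves both. *)
Lemma u2_ramp_source (phi : R -> R -> R) p q c k n s :
  locally_lipschitz (phi q) -> phi q 0 = 0 -> 0 < c -> 0 < k -> 0 <= s ->
  u2_ phi p q (ramp_source (phi q) c k n) s = ramp_source (phi p) c k n s.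
Proof.
by move=> qL q0 c0 k0 s0; rewrite /u2_ u_ramp_source// /ramp_source; ring.
Qed.

End ramp.

(** * Laplace functionals as the test functions increase *)

Section mass_limit.
Context (R : realType).
Local Notation mR := (measurableTypeR R).
Local Notation H := (`[0, +oo[%classic : set mR).

(* exp(- lam M), with value 0 at M = oo, for lam > 0 *)
Definition laplace_exp (lam : R) (M : \bar R) : R :=
  if M is r%:E then expR (- (lam * r)) else 0.

Variables (m : {measure set mR -> \bar R}) (W : R -> R).
Hypothesis m_fin : forall N : R, (m `[0%R, N]%classic < +oo)%E.
Hypothesis W_meas : measurable_fun H (W : mR -> mR).
Hypothesis W_ge0 : forall t, 0 <= t -> 0 <= W t.
Hypothesis W_bnd : forall N : R, exists B, forall t, 0 <= t <= N -> W t <= B.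

Variables (psi : R -> R) (c k : R).
Hypotheses (psi_lip : locally_lipschitz psi) (psi0 : psi 0 = 0).
Hypotheses (c0 : 0 < c) (k0 : 0 < k) (psic : 0 < psi c).
Hypothesis source_ge0 : forall n s, 0 <= ramp_source psi c k n s.

Let mH : measurable H. Proof. exact: measurable_itv. Qed.

Lemma integrable_ramp_source n :
  m.-integrable H (EFin \o (fun s => ramp_source psi c k n s * W s)).
Proof.
have [B HB] := W_bnd (n%:R + c / k).
have [C HC] := ramp_source_bounded psi_lip psi0 c0 k0.
apply: (@csupp_integrable _ m H _ (C * B) (n%:R + c / k)) => //.
- apply: measurable_funM => //.
  exact: measurable_ramp_source.
- move=> t; rewrite /= in_itv/= andbT => t0 tN.
  rewrite normrM ler_pM// (ger0_norm (W_ge0 t0)) HB// t0//.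
- move=> t _ Nt; rewrite ramp_source_after ?mul0r//.
Qed.

(** The density [W] lets one statement cover both state spaces: [W = 1] for a Radon measure [m], and
    Lebesgue measure with a path for [W]. A finite mass is treated by dominated convergence, an
    infinite one by a divergent minorant. *)
Lemma mass_limit :
  expR (- \int[m]_(s in H) (ramp_source psi c k n s * W s)) @[n --> \oo] -->
  laplace_exp (psi c) (\int[m]_(s in H) (W s)%:E)%E.
Proof.
have W0 : (0 <= \int[m]_(s in H) (W s)%:E)%E.
  by apply: integral_ge0 => t; rewrite /= in_itv/= andbT => /W_ge0; rewrite lee_fin.
have [C HC] := ramp_source_bounded psi_lip psi0 c0 k0.
have mW : measurable_fun H (EFin \o W) by exact/measurable_EFinP.
have fn n : (\int[m]_(s in H) (ramp_source psi c k n s * W s)%:E)%E \is a fin_num.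
  exact: (integrable_fin_num mH (integrable_ramp_source n)).
case E : (\int[m]_(s in H) (W s)%:E)%E => [M| |] /=; last by rewrite E in W0.
- apply: continuous_cvg; first exact: continuous_expR.
  apply: cvgN.
  have iW : m.-integrable H (EFin \o W).
    apply/integrableP; split => //.
    rewrite (_ : (\int[m]_(x in H) _)%E = M%:E) ?ltry// -E.
    by apply: eq_integral => t; rewrite inE/= in_itv/= andbT => /W_ge0 h; rewrite ger0_norm.
  have -> : psi c * M = fine (\int[m]_(s in H) (psi c * W s)%:E)%E.
    rewrite (_ : (\int[m]_(s in H) (psi c * W s)%:E)%E = (psi c)%:E * M%:E)%E// -E.
    by rewrite -(integralZl mH iW).
  apply: fine_cvg; rewrite fineK; last first.
    exact: (integrable_fin_num mH (integrableZl mH (psi c) iW)).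
  apply: (@dominated_cvg _ _ _ m H mH (fun n s => (ramp_source psi c k n s * W s)%:E) _
     (fun s => C%:E * (W s)%:E)%E).
  + move=> n; apply/measurable_EFinP; apply: measurable_funM => //.
    exact: measurable_ramp_source.
  + move=> s Hs; apply: cvg_near_cst; near=> n; rewrite ramp_source_before//.
    by near: n; exact: nbhs_infty_ger.
  + by [].
  + exact: integrableZl.
  + move=> n s; rewrite /= in_itv/= andbT => s0; rewrite lee_fin normrM.
    by rewrite (ger0_norm (W_ge0 s0)) ler_wpM2r ?W_ge0.
(* The source need not increase with n, because of its descent part; this minorant, its part before
   time n, does, and monotone convergence applies to it. *)
- pose h n (s : mR) := ((psi c)%:E * ((W s)%:E * (\1_(`[0, n%:R]%classic : set mR) s)%:E))%E.
  have mh n : measurable_fun H (h n).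
    apply: emeasurable_funM => //; apply: emeasurable_funM => //.
    by apply/measurable_EFinP; apply: measurable_indic.
  have i01 (s : mR) n : 0 <= (\1_(`[0, n%:R]%classic : set mR) s : R) <= 1.
    by rewrite indicE; case: (_ \in _); rewrite ?lexx ?ler01.
  have h0 n s : H s -> (0 <= h n s)%E.
    rewrite /= in_itv/= andbT => s0; have /andP[i0 _] := i01 s n.
    by rewrite /h mule_ge0 ?mule_ge0 ?lee_fin ?W_ge0// ltW.
  have hoo : (\int[m]_(s in H) h n s)%E @[n --> \oo] --> +oo%E.
    have := @cvg_monotone_convergence _ _ _ m H mH h mh h0.
    rewrite (_ : (\int[m]_(s in H) _)%E = +oo%E); last first.
      transitivity (\int[m]_(s in H) ((psi c)%:E * (W s)%:E))%E.
        apply: eq_integral => s; rewrite inE/= in_itv/= andbT => s0; apply/cvg_lim => //.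
        apply: cvg_near_cst; near=> n; rewrite /h indicE mem_set ?mule1//.
        by rewrite /= in_itv/= s0/=; near: n; exact: nbhs_infty_ger.
      rewrite ge0_integralZl//; first by rewrite E gt0_muley ?lte_fin.
      - by move=> s; rewrite /= in_itv/= andbT => /W_ge0; rewrite lee_fin.
      - by rewrite lee_fin ltW.
    apply => s Hs p q pq; rewrite /h lee_pmul2l// ?lte_fin//.
    apply: lee_wpmul2l.
      by move: Hs; rewrite /= in_itv/= andbT => /W_ge0; rewrite lee_fin.
    rewrite lee_fin !indicE; case: (boolP (s \in `[0, p%:R]%classic)) => //.
    rewrite inE/= in_itv/= => /andP[s0 sp]; rewrite mem_set//= in_itv/= s0/=.
    by rewrite (le_trans sp)// ler_nat.
  have Ioo : \int[m]_(s in H) (ramp_source psi c k n s * W s) @[n --> \oo] --> +oo.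
    apply/cvgeryP.
    apply: gee_cvgy hoo; apply: nearW => n /=; rewrite /Rintegral fineK//.
    apply: ge0_le_integral => //; first exact: h0.
    + by apply/measurable_EFinP; apply: measurable_funM => //; exact: measurable_ramp_source.
    + move=> s; rewrite /= in_itv/= andbT => s0; rewrite /h -!EFinM lee_fin.
      rewrite mulrCA mulrC ler_wpM2r ?W_ge0// indicE.
      case: (boolP (s \in _)) => [|_]; last by rewrite mulr0.
      by rewrite inE/= in_itv/= s0/= mulr1 => sn; rewrite ramp_source_before.
  have := cvg_comp _ _ Ioo (@cvgr_expR R).
  by apply: cvg_trans; apply: near_eq_cvg; apply: nearW.
Unshelve. all: by end_near. Qed.

End mass_limit.

(** * Measurability for the vague topology *)

Section radon.
Context (R : realType).
Local Notation mR := (measurableTypeR R).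
Local Notation H := (`[0, +oo[%classic : set mR).
Local Notation rad := (radonType R).

Let mH : measurable H. Proof. exact: measurable_itv. Qed.

Lemma radon_vague_open (f : R -> R) (U : set R) : continuous_csupp f -> open U ->
  open [set nu : radon_measure R | U (\int[nu]_(s in H) f s)].
Proof.
move=> cf oU; pose A := [set nu : radon_measure R | U (\int[nu]_(s in H) f s)].
exists [set A]; last by rewrite bigcup_set1.
move=> _ ->; exists (fset1 (f, U)); last by rewrite set_fset1 bigcap_set1.
by move=> i; rewrite in_fset1 => /eqP ->; exact: mem_set.
Qed.

Lemma measurable_radon_integral (f : R -> R) : continuous_csupp f ->
  measurable_fun setT (fun nu : rad => \int[radon_val nu]_(s in H) f s : mR).
Proof.
move=> cf; apply: (measurability _ (RGenOInfty.measurableE R)) => //.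
move=> _ [_ [a ->] <-]; rewrite setTI; apply: sub_sigma_algebra.
apply: (@radon_vague_open f `]a, +oo[%classic) => //.
Qed.

Lemma radon_integrable (nu : rad) (f : R -> R) : bounded_pos_csupp f ->
  (radon_val nu).-integrable H (EFin \o f).
Proof.
move=> [mf f0 [C fC] [N fN]]; apply: (@csupp_integrable _ (radon_val nu) _ _ C N) => //.
- move=> t; rewrite /= in_itv/= andbT => t0 _; rewrite ger0_norm ?f0// fC//.
- by move=> t _ /fN.
- exact: radon_fin.
Qed.

Lemma ramp_continuous_csupp (phi : R -> R) (c k : R) n : locally_lipschitz phi ->
  phi 0 = 0 -> 0 < c -> 0 < k -> continuous_csupp (phi \o ramp c k n).
Proof.
move=> phiL phi0 c0 k0; split.
  apply: continuous_subspaceT => x.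
  rewrite (_ : phi \o _ = (fun x => phi (Num.max 0 x)) \o ramp c k n); last first.
    by apply/funext => t /=; rewrite max_r// ramp_ge0.
  apply: continuous_comp; first exact: continuous_ramp.
  exact: continuous_phi_max.
by exists (n%:R + c / k) => s /ltW ns; rewrite /= ramp_after.
Qed.

Lemma locally_lipschitz_id : locally_lipschitz (@id R).
Proof. by move=> C; exists 1 => // x y _ _; rewrite mul1r. Qed.

(** Mass can escape to infinity, so the total mass is not vaguely continuous; it is the increasing
    limit of the vaguely continuous integrals of ramps. *)
Lemma measurable_radon_mass : measurable_fun setT (@radon_mass R).
Proof.
pose g n (nu : rad) := ((\int[radon_val nu]_(s in H) ramp 1 1 n s)%:E : \bar R).
apply: (@emeasurable_fun_cvg _ _ _ _ g) => [n|nu _].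
  apply/measurable_EFinP; apply: measurable_radon_integral.
  exact: (ramp_continuous_csupp n locally_lipschitz_id erefl ltr01 ltr01).
have -> : radon_mass nu = (\int[radon_val nu]_(s in H) limn (fun n => (ramp 1 1 n s)%:E))%E.
  rewrite -[LHS]mul1e -(integral_cst (radon_val nu) mH 1%E); apply: eq_integral => s _.
  apply/esym/cvg_lim => //; apply: cvg_near_cst; near=> n.
  by rewrite ramp_before//; near: n; exact: nbhs_infty_ger.
rewrite (_ : g ^~ nu = fun n => (\int[radon_val nu]_(s in H) (ramp 1 1 n s)%:E)%E).
  apply: cvg_monotone_convergence => //.
  - move=> n; apply/measurable_EFinP; apply: measurable_funTS.
    by apply: continuous_measurable_fun; exact: continuous_ramp.
  - by move=> n x _; rewrite lee_fin ramp_ge0.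
  - move=> x _ n p np; rewrite lee_fin /ramp.
    have : n%:R <= p%:R :> R by rewrite ler_nat.
    move=> np'; rewrite ge_max !le_max lexx/= le_min !ge_min lexx/=.
    by apply/orP; right; apply/orP; right; lra.
apply/funext => n; rewrite /g /Rintegral fineK//.
apply: integrable_fin_num => //; apply: radon_integrable.
exact: ramp_bounded_pos_csupp.
Unshelve. all: by end_near. Qed.

(** Needed for the jump part of a ramp source. The indicator of an open interval is the pointwise
    limit of the continuous functions [tent n], which rise from 0 at the end points with slope n and
    are cut off at 1. *)
Lemma measurable_radon_itv (a b : R) : 0 <= a ->
  measurable_fun setT (fun nu : rad =>
    \int[radon_val nu]_(s in H) \1_(`]a, b[%classic : set mR) s : mR).
Proof.
move=> a0.
pose tent n (s : R) := Num.max 0 (Num.min 1 (n%:R * Num.min (s - a) (b - s))).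
have ctent n : continuous (tent n : R -> R).
  move=> s.
  have h1 : {for s, continuous (fun t : R => 1 : R^o)} by exact: cvg_cst.
  have h2 : {for s, continuous (fun t : R => 0 : R^o)} by exact: cvg_cst.
  have h3 : {for s, continuous (fun t : R => t - a : R^o)}.
    by apply: cvgB; [exact: cvg_id|exact: cvg_cst].
  have h4 : {for s, continuous (fun t : R => b - t : R^o)}.
    by apply: cvgB; [exact: cvg_cst|exact: cvg_id].
  have h5 : {for s, continuous (fun t : R => n%:R * Num.min (t - a) (b - t) : R^o)}.
    by apply: cvgMr; exact: (continuous_min h3 h4).
  exact: (continuous_max h2 (continuous_min h1 h5)).
have tent_out n s : ~~ (s \in `]a, b[) -> tent n s = 0.
  rewrite in_itv/= negb_and -!leNgt => h.
  rewrite /tent max_l// ge_min; apply/orP; right.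
  rewrite mulr_ge0_le0// ge_min !subr_le0; exact: h.
have tent01 n s : 0 <= tent n s <= 1.
  by rewrite /tent le_max lexx ge_max ler01 ge_min lexx.
have tent_csupp n : bounded_pos_csupp (tent n).
  split.
  - by apply: measurable_funTS; exact: continuous_measurable_fun.
  - by move=> s _; have /andP[] := tent01 n s.
  - by exists 1 => s _; have /andP[] := tent01 n s.
  - exists b => s bs; rewrite tent_out// in_itv/= negb_and -!leNgt (ltW bs).
    by rewrite orbT.
apply: (measurable_fun_cvg (h := fun n (nu : rad) => \int[radon_val nu]_(s in H) tent n s)).
  move=> n; apply: measurable_radon_integral; split.
    exact: continuous_subspaceT.
  by have [_ _ _] := tent_csupp n.
move=> nu _.
have iI : (radon_val nu).-integrable H (EFin \o (\1_(`]a, b[%classic : set mR) : mR -> R)).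
  apply: radon_integrable; split.
  - exact: measurable_indic.
  - by move=> s _; rewrite indicE; case: (_ \in _).
  - by exists 1 => s _; rewrite indicE; case: (_ \in _).
  - exists b => s bs; rewrite indicE (_ : _ \in _ = false)//.
    by apply/negbTE; rewrite notin_setE/= in_itv/= => /andP[_]; rewrite ltNge (ltW bs).
apply: fine_cvg; rewrite fineK; last exact: (integrable_fin_num mH iI).
apply: (@dominated_cvg _ _ _ (radon_val nu) H mH (fun n s => (tent n s)%:E) _
    (fun s => (\1_(`]a, b[%classic : set mR) s)%:E)) => //.
- move=> n; apply/measurable_EFinP; apply: measurable_funTS; exact: continuous_measurable_fun.
- move=> s _; rewrite indicE.
  case: (boolP (s \in `]a, b[)) => sab; last first.
    rewrite memNset//=; last exact/negP.
    by under eq_fun do rewrite tent_out//; exact: cvg_cst.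
  rewrite mem_set//; apply: cvg_near_cst; near=> n; rewrite /tent.
  pose d := Num.min (s - a) (b - s).
  have d0 : 0 < d by move: sab; rewrite in_itv/= /d lt_min !subr_gt0.
  rewrite -/d min_l ?max_r// -ler_pdivrMr//.
  by near: n; exact: nbhs_infty_ger.
- move=> n s _; rewrite indicE; have /andP[t0 t1] := tent01 n s.
  rewrite lee_fin ger0_norm//.
  case: (boolP (s \in `]a, b[)) => sab; first by rewrite mem_set.
  by rewrite tent_out//; case: (_ \in _).
Unshelve. all: by end_near. Qed.

Lemma measurable_radon_ramp_source (phi : R -> R) (c k : R) n : locally_lipschitz phi ->
  phi 0 = 0 -> 0 < c -> 0 < k ->
  measurable_fun setT (fun nu : rad =>
    \int[radon_val nu]_(s in H) ramp_source phi c k n s : mR).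
Proof.
move=> phiL phi0 c0 k0.
pose J := (`]n%:R, n%:R + c / k[%classic : set mR).
have iJ (nu : rad) : (radon_val nu).-integrable H (EFin \o (\1_J : mR -> R)).
  apply: radon_integrable; split.
  - by apply: measurable_indic; exact: measurable_itv.
  - by move=> s _; rewrite indicE; case: (_ \in _).
  - by exists 1 => s _; rewrite indicE; case: (_ \in _).
  - exists (n%:R + c / k) => s bs; rewrite indicE (_ : _ \in _ = false)//.
    by apply/negbTE; rewrite notin_setE/J/= in_itv/= => /andP[_]; rewrite ltNge (ltW bs).
have iphi (nu : rad) : (radon_val nu).-integrable H (EFin \o (phi \o ramp c k n)).
  have [L L0 HL] := phiL c.
  apply: (@csupp_integrable _ (radon_val nu) _ _ (L * c) (n%:R + c / k)) => //.
  - apply: measurable_phi_comp => //; last by move=> t _; exact: ramp_ge0.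
    by apply: measurable_funTS; apply: continuous_measurable_fun; exact: continuous_ramp.
  - move=> t _ _; have := HL (ramp c k n t) 0.
    rewrite phi0 !subr0 ramp_ge0 ramp_le// lexx (ltW c0)/=.
    move=> /(_ isT isT) h; apply: (le_trans h); rewrite ler_wpM2l//.
    by rewrite ger0_norm ?ramp_ge0// ramp_le.
  - by move=> t _ /ltW ?; rewrite /= ramp_after.
  - exact: radon_fin.
rewrite (_ : (fun nu : rad => _) = (fun nu : rad =>
    \int[radon_val nu]_(s in H) (phi \o ramp c k n) s +
    k * \int[radon_val nu]_(s in H) \1_J s)); last first.
  apply/funext => nu; rewrite -RintegralZl// -RintegralD//.
  exact: (integrableZl mH _ (iJ nu)).
apply: measurable_funD.
  by apply: measurable_radon_integral; exact: ramp_continuous_csupp.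
apply: measurable_funM; first exact: measurable_cst.
exact: measurable_radon_itv.
Qed.

(** * Point masses at the origin *)

Section dirac0.

Variable x : R.

(* The absolute value only makes [x delta_0] a measure for every real x. *)
Definition mass_at0 : {measure set mR -> \bar R} := mscale (NngNum (normr_ge0 x)) \d_(0 : mR).

Lemma mass_at0E (A : set mR) : mass_at0 A = (`|x|%:E * (\1_A 0)%:E)%E.
Proof. by rewrite /mass_at0/= /mscale/= diracE indicE. Qed.

Lemma mass_at0_neg : mass_at0 `]-oo, 0[%classic = 0%E.
Proof. by rewrite mass_at0E indicE memNset ?mule0//= in_itv/= ltxx. Qed.

Lemma mass_at0_fin (a : R) : (mass_at0 `[0%R, a]%classic < +oo)%E.
Proof. by rewrite mass_at0E -EFinM ltry. Qed.

Definition radon_at0 : radonType R := RadonMeasure mass_at0_neg mass_at0_fin.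

Lemma radon_mass_at0 : radon_mass radon_at0 = `|x|%:E.
Proof.
by rewrite /radon_mass/= mass_at0E indicE mem_set ?mule1//= in_itv/= lexx.
Qed.

End dirac0.

Lemma Rintegral_radon_at0 x (f : R -> R) :
  measurable_fun H (f : mR -> mR) -> \int[radon_at0 x]_(s in H) f s = `|x| * f 0.
Proof.
move=> mf; rewrite /Rintegral.
have i0 (g : mR -> \bar R) : measurable_fun H g -> (forall t, (0 <= g t)%E) ->
    (\int[radon_at0 x]_(s in H) g s)%E = (`|x|%:E * g (0%R : mR))%E.
  move=> mg g0; rewrite ge0_integral_mscale// integral_dirac// diracE.
  by rewrite mem_set ?mul1e//= in_itv/= lexx.
have mEf : measurable_fun H (EFin \o f) by exact/measurable_EFinP.
rewrite integralE !i0//; last 2 first.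
- exact: measurable_funeneg.
- exact: measurable_funepos.
rewrite funeposE funenegE -!EFin_max -!EFinM -EFinB -mulrBr; congr (_ * _).
by rewrite !maxEle; case: ifP; case: ifP; lra.
Qed.

(** The map is continuous, as it sends x to a measure whose integral of f is |x| f(0). Preimages of
    all open sets are examined, not only of subbasic ones, since the unions involved may be
    uncountable. This makes the law of the mass a kernel in x. *)
Lemma measurable_radon_at0 : measurable_fun setT (radon_at0 : mR -> rad).
Proof.
apply: (measurability _ (erefl : @measurable _ rad = _)) => //.
move=> _ [U [D sD <-] <-]; rewrite setTI; apply: open_measurable.
rewrite preimage_bigcup; apply: bigcup_open => _ /sD [F FD <-].
rewrite preimage_bigcap openE => x xF; apply: filter_bigI => -[f V] fF.
have /set_mem[/= [cf _] oV] := FD _ fF.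
have mf : measurable_fun H (f : mR -> mR) by exact: subspace_continuous_measurable_fun.
apply: open_nbhs_nbhs; split; last exact: (xF (f, V) fF).
rewrite /preimage/=.
rewrite [X in open X](_ : _ = (fun t : R => `|t| * f 0) @^-1` V); last first.
  by apply/seteqP; split=> t; rewrite /preimage /mkset -(Rintegral_radon_at0 t mf).
apply: open_comp => // t _.
by apply: cvgMl; apply: cvg_norm; exact: cvg_id.
Qed.

End radon.

(** * Measurability for the Skorokhod topology *)

Section gaps.
Context (R : realType).
Local Notation mR := (measurableTypeR R).

(** The gaps to the right of distinct points are disjoint, so a rational chosen in each gap gives an
    injection. *)
Lemma countable_right_gaps (S : set R) :
  (forall t, S t -> exists2 d, 0 < d & forall s, t < s < t + d -> ~ S s) ->
  countable S.
Proof.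
move=> gap.
have /choice[d Hd] : forall t, exists d, S t -> 0 < d /\ forall s, t < s < t + d -> ~ S s.
  move=> t; have [St|nSt] := pselect (S t); last by exists 0.
  by have [d d0 dS] := gap t St; exists d.
have /choice[r Hr] : forall t, exists q : rat, S t -> ratr q \in `]t, t + d t[.
  move=> t; have [St|nSt] := pselect (S t); last by exists 0.
  have [d0 _] := Hd t St; have [q hq] := @rat_in_itvoo R t (t + d t) ltac:(lra).
  by exists q.
have lt_neq t t' : S t -> S t' -> t < t' -> r t <> r t'.
  move=> St St' tt' rE.
  have := Hr t St; have := Hr t' St'; rewrite -rE !in_itv/= => /andP[h1 h2] /andP[h3 h4].
  by have [_ /(_ t')] := Hd t St; apply => //; lra.
apply/countable_injP; exists (choice.pickle \o r) => t t' /set_mem St /set_mem St' /=.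
move=> /(pcan_inj choice.pickleK) rE; apply/eqP; rewrite eq_le !leNgt.
by apply/andP; split; apply/negP => /lt_neq; [apply => //; exact/esym|apply].
Qed.

Lemma countable_left_gaps (S : set R) :
  (forall t, S t -> exists2 d, 0 < d & forall s, t - d < s < t -> ~ S s) ->
  countable S.
Proof.
move=> gap.
have /countable_injP[f finj] : countable [set - x | x in S].
  apply: countable_right_gaps => _ [t St <-]; have [d d0 Hd] := gap t St.
  by exists d => // s sd [u Su uE]; apply: (Hd u) => //; lra.
apply/countable_injP; exists (f \o -%R) => t t' /set_mem St /set_mem St' /= h.
by apply/oppr_inj/finj => //; apply/mem_set; [exists t|exists t'].
Qed.

(** Each point of the preimage [A] of an open upper half-line starts an interval contained in [A],
    and the inside of that interval is interior to [A]. Hence [A] is an open set together with a set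
    having right gaps, which is countable. *)
Lemma right_continuous_measurable (f : R -> R) :
  (forall t, f @ t^'+ --> f t) -> measurable_fun setT (f : mR -> mR).
Proof.
move=> fr; apply: (measurability _ (RGenOInfty.measurableE R)) => //.
move=> _ [_ [a ->] <-]; rewrite setTI.
set A := (X in measurable X).
have gap t : A t -> exists2 d, 0 < d & forall s, t < s < t + d -> A s.
  rewrite /A/= in_itv/= andbT => aft.
  have /cvgrPdist_lt/(_ (f t - a)) := fr t.
  rewrite subr_gt0 => /(_ aft) /nbhs_ballP[d /= d0 Hd].
  exists d => // s /andP[ts sd]; have : ball t d s.
    by rewrite /ball/= ltr0_norm ?subr_lt0//; lra.
  by move=> /Hd /(_ ts); rewrite /A/= in_itv/= andbT ltr_norml => /andP[_]; lra.
have -> : A = A° `|` (A `\` A°).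
  by rewrite setDE setUIr setUCr setIT; apply/esym/setUidPr; exact: interior_subset.
apply: measurableU.
  by apply: open_measurable; exact: open_interior.
apply: countable_measurable => //; apply: countable_right_gaps => t [/gap[d d0 Hd] nA].
exists d => // s sd [As]; apply.
have : \forall u \near s, u \in `]t, t + d[ by apply: near_in_itvoo; rewrite in_itv.
by apply: filterS => u; rewrite in_itv/=; exact: Hd.
Qed.

End gaps.

(** * Regularity of càdlàg paths *)

Section cadlag_paths.
Context (R : realType).
Local Notation mR := (measurableTypeR R).
Local Notation H := (`[0, +oo[%classic : set mR).
Implicit Type w : cadlag R.

Let mH : measurable H. Proof. exact: measurable_itv. Qed.

Lemma cadlag_bounded w (N : R) : exists B, forall t, 0 <= t <= N -> w t <= B.
Proof.
have /compact_near_coveringP cov := @segment_compact R 0 N.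
have [B [_ HB]] : \forall B \near +oo, `[0, N]%classic `<=` (fun t => 0 <= t -> w t <= B).
  apply: cov => t; rewrite /= in_itv/= => /andP[t0 tN].
  have right : \forall s \near t, t < s -> w s < w t + 1.
    have /cvgrPdist_lt/(_ 1 ltr01) := @cadlag_right R w t t0.
    rewrite near_withinE; apply: filterS => s h /h.
    by rewrite ltr_norml => /andP[h1 _]; lra.
  have left : exists L, \forall s \near t, s < t -> 0 <= s -> w s < L.
    move: t0; rewrite le_eqVlt => /predU1P[<-|t0].
      by exists 0; near=> s => s0; rewrite leNgt s0.
    have /cvg_ex[/= L /cvgrPdist_lt/(_ 1 ltr01)] := @cadlag_left R w t t0.
    rewrite near_withinE => h; exists (L + 1); apply: filterS h => s h /h h' _.
    by move: h'; rewrite ltr_norml => /andP[h1 _]; lra.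
  have [L hL] := left.
  exists ([set s | (t < s -> w s < w t + 1) /\ (s < t -> 0 <= s -> w s < L)],
     [set B | Num.max L (w t + 1) <= B]).
    split; first exact: (filterI right hL).
    by apply: nbhs_pinfty_ge; exact: num_real.
  move=> [s B] /= [[h1 h2] hB] s0.
  have [lt_st|lt_ts|->] := ltgtP s t.
  - by apply: le_trans hB; rewrite le_max (ltW (h2 lt_st s0)).
  - by apply: le_trans hB; rewrite le_max (ltW (h1 lt_ts)) orbT.
  - by apply: le_trans hB; rewrite le_max; apply/orP; right; rewrite lerDl.
exists (B + 1) => t t0N; have /andP[t0 _] := t0N.
by apply: (HB (B + 1)) => //; rewrite ltrDl.
Unshelve. all: by end_near. Qed.

Lemma measurable_cadlag w : measurable_fun setT (w : mR -> mR).
Proof.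
apply: right_continuous_measurable => t; have [t0|t0] := leP 0 t.
  exact: cadlag_right.
apply: cvg_at_right_filter; rewrite (@cadlag_neg0 R w t t0).
apply: cvg_near_cst; near=> s; apply: cadlag_neg0.
by near: s; exact: lt_nbhsl.
Unshelve. all: by end_near. Qed.

(** Jumps of at least a given size are isolated from the left, because a left limit exists at every
    point; a sequence of sizes tending to 0 captures all jumps. *)
Lemma countable_cadlag_jumps w : countable [set t | ~ (w @ t^'- --> w t)].
Proof.
pose L t := lim (w @ t^'-).
have LP t : w @ t^'- --> L t.
  have [t0|t0] := ltP 0 t; first exact: cadlag_left.
  apply: (@cvgP _ _ 0); apply: cvg_near_cst; near=> s; apply: cadlag_neg0.
  by apply: lt_le_trans t0; near: s; exact: nbhs_left_lt.
pose J n := [set t | n.+1%:R^-1 <= `|w t - L t|].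
apply: (@sub_countable _ _ _ (\bigcup_n J n)); last first.
  apply: bigcup_countable => // n _; apply: countable_left_gaps => t tJ.
  (* Within e of the left limit at t, a jump at s < t is smaller than 2 e, hence below the threshold
     of [J n]. *)
  pose e : R := n.+1%:R^-1 / 3.
  have n0 : (0 : R) < n.+1%:R^-1 by rewrite invr_gt0.
  have e0 : 0 < e by rewrite divr_gt0.
  have /cvgrPdist_lt/(_ e e0) := LP t.
  rewrite near_withinE => /nbhs_ballP[d /= d0 Hd].
  exists d => //.
  move=> s /andP[sd st] sJ.
  have near_s r : t - d < r -> r < t -> `|L t - w r| < e.
    by move=> dr rt; apply: (Hd r) => //; rewrite /ball/= gtr0_norm ?subr_gt0//; lra.
  have h1 : `|L t - L s| <= e.
    have h : `|L t - w r| @[r --> s^'-] --> `|L t - L s|.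
      by apply: cvg_norm; apply: cvgB; [exact: cvg_cst|exact: LP].
    apply: (ler_cvg_to h (cvg_cst e)); near=> r; apply/ltW/near_s; near: r.
      by apply: nbhs_left_gt; lra.
    near=> r; apply: lt_trans st; near: r; exact: nbhs_left_lt.
  have h2 : `|L t - w s| < e by apply: near_s => //; lra.
  have : `|w s - L s| <= `|L t - w s| + `|L t - L s|.
    rewrite (distrC _ (w s)) (_ : w s - L s = (w s - L t) + (L t - L s)); last by ring.
    exact: ler_normD.
  by move: sJ n0 h1 h2; rewrite /J /mkset /e; set x : R := n.+1%:R^-1; lra.
apply: subset_card_le => t nwt; have dpos : 0 < `|w t - L t|.
  rewrite normr_gt0 subr_eq0; apply: contra_notN nwt => /eqP ->; exact: LP.
have [n _ /(_ n (leqnn n)) hn] := near_infty_natSinv_lt (PosNum dpos).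
by exists n => //; exact: ltW.
Unshelve. all: by end_near. Qed.

End cadlag_paths.

Section skorokhod.
Context (R : realType).
Local Notation mR := (measurableTypeR R).
Local Notation H := (`[0, +oo[%classic : set mR).
Local Notation leb := (@lebesgue_measure R).
Implicit Type w : cadlag R.

Let mH : measurable H. Proof. exact: measurable_itv. Qed.

(** By surjectivity of the time change, t = l(r) with r close to t. Then [ws k t] is close to [w r],
    which is close to [w t] by continuity at t; the horizon k eventually exceeds r. *)
Lemma skorokhod_cvg w (ws : nat -> cadlag R) t : 0 <= t -> w @ t^'- --> w t ->
  (forall k, skorokhod_ball w k%:R k.+1%:R^-1 (ws k)) -> ws k t @[k --> \oo] --> w t.
Proof.
move=> t0 wl ball_w; apply/cvgrPdist_lt => e e0.
have e20 : 0 < e / 2 by rewrite divr_gt0.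
have [d d0 Hd] : exists2 d, 0 < d & forall s, `|t - s| < d -> `|w t - w s| < e / 2.
  have /cvgrPdist_lt/(_ _ e20) := wl.
  have /cvgrPdist_lt/(_ _ e20) := @cadlag_right R w t t0.
  rewrite !near_withinE => /nbhs_ballP[d1 /= d10 h1] /nbhs_ballP[d2 /= d20 h2].
  exists (Num.min d1 d2); first by rewrite lt_min d10.
  move=> s; rewrite lt_min => /andP[s1 s2].
  have [st|ts|<-] := ltgtP s t; first exact: h2.
    exact: h1.
  by rewrite subrr normr0.
near=> k.
have kd : k.+1%:R^-1 < d by near: k; exact: (near_infty_natSinv_lt (PosNum d0)).
have ke : k.+1%:R^-1 < e / 2 by near: k; exact: (near_infty_natSinv_lt (PosNum e20)).
have kt : t + d <= k%:R by near: k; exact: nbhs_infty_ger.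
have [l [[_ _ lsurj] _] [l1 l2]] := ball_w k.
have [r] : [set l x | x in `[0, +oo[%classic] t.
  by apply: lsurj; rewrite /= in_itv/= t0.
rewrite /= in_itv/= andbT => r0 rt.
have tr : `|t - r| < d by rewrite -rt (lt_trans (l1 r r0)).
have rk : 0 <= r <= k%:R.
  by rewrite r0/=; move: tr; rewrite ltr_norml => /andP[+ _]; lra.
have := l2 r rk; rewrite rt => /lt_trans/(_ ke) h2; have h1 := Hd r tr.
have : `|w t - ws k t| <= `|w t - w r| + `|ws k t - w r|.
  rewrite (distrC (ws k t)) (_ : w t - ws k t = (w t - w r) + (w r - ws k t)); last by ring.
  exact: ler_normD.
lra.
Unshelve. all: by end_near. Qed.

Lemma measurable_weighted_path (f : R -> R) (D : set mR) w :
  measurable D -> measurable_fun D (f : mR -> mR) ->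
  measurable_fun D (fun s : mR => (f s * w s)%:E).
Proof.
move=> mD mf; apply/measurable_EFinP; apply: measurable_funM => //.
by apply: measurable_funTS; exact: measurable_cadlag.
Qed.

(* By Fatou's lemma: J1 convergence implies convergence at the continuity points
   of the limit, hence almost everywhere. *)
Lemma cadlag_integral_lsc (f : R -> R) (a : R) :
  measurable_fun H (f : mR -> mR) -> (forall s, 0 <= s -> 0 <= f s) ->
  skorokhod_open [set w | (a%:E < \int[leb]_(s in H) (f s * w s)%:E)%E].
Proof.
move=> mf f0 w /= aw; apply: contrapT => nopen.
have /choice[ws Hws] : forall k : nat, exists w', skorokhod_ball w k%:R k.+1%:R^-1 w' /\
    (\int[leb]_(s in H) (f s * w' s)%:E <= a%:E)%E.
  move=> k; apply: contrapT => nk; apply: nopen; exists k%:R, k.+1%:R^-1.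
  split; first by rewrite invr_gt0.
  move=> w' bw'; rewrite /= ltNge; apply/negP => h; apply: nk; by exists w'.
pose N := ([set t | ~ (w @ t^'- --> w t)] : set mR).
have cN : countable N := countable_cadlag_jumps w.
have mN : measurable N by exact: countable_measurable.
have N0 : leb N = 0%E by exact: countable_lebesgue_measure0.
have mHN : measurable (H `\` N) by exact: measurableD.
have HN0 s : (H `\` N) s -> 0 <= s by case; rewrite /= in_itv/= andbT.
have pos v s : 0 <= s -> (0 <= (f s * cadlag_val v s)%:E)%E.
  by move=> s0; rewrite lee_fin mulr_ge0 ?f0 ?cadlag_ge0.
have posH v s : H s -> (0 <= (f s * cadlag_val v s)%:E)%E.
  by rewrite /= in_itv/= andbT; exact: pos.
have mfHN : measurable_fun (H `\` N) (f : mR -> mR).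
  by apply: measurable_funS mf => // x [].
have rmN v : (\int[leb]_(s in H) (f s * cadlag_val v s)%:E =
              \int[leb]_(s in H `\` N) (f s * cadlag_val v s)%:E)%E.
  apply: ge0_negligible_integral => //; first exact: measurable_weighted_path.
  exact: posH.
have : (\int[leb]_(s in H `\` N) (f s * w s)%:E <= a%:E)%E.
  rewrite (_ : (\int[leb]_(s in _) _)%E =
    (\int[leb]_(s in H `\` N) limn_einf (fun k => (f s * ws k s)%:E))%E); last first.
    apply: eq_integral => s /set_mem [Hs Ns].
    apply/esym; apply: (cvg_limn_einf_sup _).1.
    apply: cvg_EFin; first exact: nearW.
    apply: cvgMr; apply: skorokhod_cvg.
    - by move: Hs; rewrite /= in_itv/= andbT.
    - exact: contrapT.
    - by move=> k; have [] := Hws k.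
  apply: le_trans.
    apply: (@fatou _ _ _ leb _ mHN (fun k s => (f s * ws k s)%:E)).
      by move=> k; exact: measurable_weighted_path.
    by move=> k s /HN0; exact: pos.
  rewrite limn_einf_lim; apply: lime_le; first exact: is_cvg_einfs.
  apply: nearW => k; apply: (@le_trans _ _ (\int[leb]_(s in H `\` N) (f s * ws k s)%:E)%E).
    by apply: ereal_inf_lbound; exists k => /=.
  by rewrite -rmN; have [] := Hws k.
by rewrite -rmN leNgt aw.
Qed.

Lemma measurable_cadlag_integral (f : R -> R) :
  measurable_fun H (f : mR -> mR) -> (forall s, 0 <= s -> 0 <= f s) ->
  measurable_fun setT (fun w : cadlagType R =>
    \int[leb]_(s in H) (f s * cadlag_val w s)%:E)%E.
Proof.
move=> mf f0; apply: (measurability _ (ErealGenOInfty.measurableE R)) => //.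
move=> _ [_ [a ->] <-]; rewrite setTI; apply: sub_sigma_algebra.
rewrite [X in open X](_ : _ = [set w | (a%:E < \int[leb]_(s in H) (f s * cadlag_val w s)%:E)%E]).
  exact: cadlag_integral_lsc.
by apply/seteqP; split=> w; rewrite /= in_itv/= andbT.
Qed.

Lemma measurable_path_mass : measurable_fun setT (@path_mass R).
Proof.
have := @measurable_cadlag_integral (cst 1) (measurable_cst _) (fun _ _ => ler01).
apply: eq_measurable_fun => w _; apply: eq_integral => s _.
by rewrite mul1r.
Qed.

End skorokhod.

(** * Uniqueness of the Laplace transform *)

Section laplace_uniqueness.
Context (R : realType).
Local Notation mR := (measurableTypeR R).
Local Notation H := (`[0, +oo[%classic : set mR).

Let mH : measurable H. Proof. exact: measurable_itv. Qed.

(** Bernoulli's inequality. *)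
Lemma ler_onemX (a : R) n : 0 <= a <= 1 -> 1 - a *+ n <= (1 - a) ^+ n.
Proof.
move=> /andP[a0 a1]; elim: n => [|n IH]; first by rewrite mulr0n subr0 expr0.
rewrite exprS mulrS; have h : 0 <= a *+ n by rewrite mulrn_wge0.
have := ler_wpM2l (_ : 0 <= 1 - a) IH; rewrite subr_ge0 => /(_ a1).
by apply: le_trans; rewrite mulrBr mulr1 mulrBl mul1r; nra.
Qed.

(* An exponential polynomial that tends to the indicator of s > t, as
   e^{-s ln 2 / t} < 1/2 iff s > t. The exponent n 2^n, instead of 2^n, makes the
   limit 0 also at s = t. *)
Definition laplace_kernel (n : nat) (t s : R) : R :=
  (1 - expR (- (n%:R * (ln 2 / t) * s))) ^+ (n * 2 ^ n).

Lemma laplace_kernel01 n t s : 0 < t -> 0 <= s -> 0 <= laplace_kernel n t s <= 1.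
Proof.
move=> t0 s0; have l2 : 0 <= n%:R * (ln 2 / t) * s :> R.
  by rewrite mulr_ge0// mulr_ge0// divr_ge0 ?(ltW t0)// ln_ge0// ler1n.
have e0 := expR_gt0 (- (n%:R * (ln 2 / t) * s)).
have e1 : expR (- (n%:R * (ln 2 / t) * s)) <= 1 by rewrite -[leRHS]expR0 ler_expR oppr_le0.
have o0 : 0 <= 1 - expR (- (n%:R * (ln 2 / t) * s)) by rewrite subr_ge0.
have o1 : 1 - expR (- (n%:R * (ln 2 / t) * s)) <= 1 by rewrite lerBlDr lerDl ltW.
by rewrite exprn_ge0//= exprn_ile1.
Qed.

(** Put a = 2^{-ns/t}. If s <= t, then 2^n a >= 1 and (1 - a)^{n 2^n} <= e^{-n}. If s > t, Bernoulli
    gives the lower bound 1 - n 2^n a = 1 - n e^{-nh} with h = ln 2 (s/t - 1) > 0, and n e^{-nh} <=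
    2 / (h^2 n) because e^x >= 1 + x^2/2. *)
Lemma cvg_laplace_kernel t s : 0 < t -> 0 <= s ->
  laplace_kernel n t s @[n --> \oo] --> (\1_(`]t, +oo[%classic : set mR) s : R).
Proof.
move=> t0 s0; rewrite indicE.
have ln2 : 0 < ln 2 :> R by rewrite ln_gt0// ltr1n.
have two n : (2 ^ n)%N%:R = expR (n%:R * ln 2) :> R.
  by rewrite natrX mulrC expRM_natr lnK// posrE.
have [st|ts] := leP s t.
  rewrite memNset/=; last by rewrite in_itv/= andbT; apply/negP; rewrite -leNgt.
  apply: (@squeeze_cvgr _ _ _ _ (cst 0) (fun n => expR (- n%:R))); last 2 first.
  - exact: cvg_cst.
  - exact: cvgn_expR.
  apply: nearW => n; have /andP[-> _] /= := laplace_kernel01 n t0 s0.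
  rewrite /laplace_kernel; set a := expR (- (n%:R * (ln 2 / t) * s)).
  have a1 : 1 - a <= expR (- a) by exact: expR_ge1Dx.
  have a2 : (2 ^ n)%N%:R^-1 <= a.
    rewrite two -expRN ler_expR lerN2 -mulrA ler_wpM2l// mulrAC ler_pdivrMr//.
    by rewrite ler_wpM2l// ltW.
  have a3 : a <= 1.
    by rewrite -[leRHS]expR0 ler_expR oppr_le0 mulr_ge0// mulr_ge0// divr_ge0// ltW.
  apply: (le_trans (lerXn2r _ _ _ a1)); rewrite ?nnegrE ?expR_ge0 ?subr_ge0//.
  rewrite -expRM_natr ler_expR mulNr lerN2 natrM mulrCA -[leLHS]mulr1.
  by rewrite ler_wpM2l// mulrC -ler_pdivrMl ?mulr1// ltr0n expn_gt0.
rewrite mem_set/=; last by rewrite in_itv/= ts.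
pose h := ln 2 * (s / t - 1).
have h0 : 0 < h by rewrite mulr_gt0// subr_gt0 ltr_pdivlMr// mul1r.
have hn n : (0 < n)%N -> n%:R * expR (- (n%:R * h)) <= 2 / h ^+ 2 * n%:R^-1.
  move=> n0; have n0' : (0 : R) < n%:R by rewrite ltr0n.
  have := @expR_ge1Dxn R (n%:R * h) 1 (mulr_ge0 (ltW n0') (ltW h0)).
  rewrite expRN => e.
  rewrite -ler_pdivlMr ?invr_gt0 ?expR_gt0// invrK.
  have h2 : 0 < h ^+ 2 by rewrite exprn_gt0.
  apply: (@le_trans _ _ (2 / h ^+ 2 * n%:R^-1 * (1 + (n%:R * h) ^+ 2 / 2))).
    rewrite [leRHS](_ : _ = 2 / h ^+ 2 * n%:R^-1 + n%:R).
      by rewrite lerDr mulr_ge0// ?divr_ge0 ?invr_ge0 ?ltW.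
    by field; rewrite !gt_eqF.
  by rewrite ler_wpM2l// mulr_ge0// ?divr_ge0 ?invr_ge0 ?ltW.
apply: (@squeeze_cvgr _ _ _ _ (fun n => 1 - 2 / h ^+ 2 * n%:R^-1) (cst 1)); last 2 first.
- rewrite -[X in _ --> X]subr0; apply: cvgB; first exact: cvg_cst.
  rewrite -[X in _ --> X](mulr0 (2 / h ^+ 2)); apply: cvgMr.
  by apply/gtr0_cvgV0; [near=> n; rewrite ltr0n; near: n; exact: nbhs_infty_gt|exact: cvgr_idn].
- exact: cvg_cst.
near=> n; have /andP[_ ->] /= := laplace_kernel01 n t0 s0; rewrite andbT.
have n0 : (0 < n)%N by near: n; exact: nbhs_infty_gt.
rewrite /laplace_kernel; set a := expR (- (n%:R * (ln 2 / t) * s)).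
have a3 : a <= 1.
  by rewrite -[leRHS]expR0 ler_expR oppr_le0 mulr_ge0// mulr_ge0// divr_ge0// ltW.
apply: le_trans (ler_onemX _ _); last by rewrite expR_ge0.
rewrite lerD2l lerN2; apply: le_trans (hn n n0).
rewrite -(mulr_natr a) natrM mulrC -mulrA ler_wpM2l// two -expRD ler_expR.
by rewrite le_eqVlt; apply/orP; left; apply/eqP; rewrite /h; field; rewrite gt_eqF.
Unshelve. all: by end_near. Qed.

Lemma measurable_expRNM lam : measurable_fun H ((fun s => expR (- (lam * s))) : mR -> mR).
Proof.
by apply: measurableT_comp => //; apply: measurable_funN; exact: measurable_funM.
Qed.

Section finite_measures.
Variables m1 m2 : {measure set mR -> \bar R}.
Hypotheses (m1fin : (m1 setT < +oo)%E) (m2fin : (m2 setT < +oo)%E).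
Hypotheses (m1neg : m1 `]-oo, 0[%classic = 0%E) (m2neg : m2 `]-oo, 0[%classic = 0%E).
Hypothesis m12 : forall lam, 0 < lam ->
  (\int[m1]_(y in H) (expR (- (lam * y)))%:E = \int[m2]_(y in H) (expR (- (lam * y)))%:E)%E.

Let fin_integrable (m : {measure set mR -> \bar R}) (g : R -> R) :
  (m setT < +oo)%E -> measurable_fun H (g : mR -> mR) ->
  (forall s, 0 <= s -> `|g s| <= 1) -> m.-integrable H (EFin \o g).
Proof.
move=> mfin mg g1; apply: measurable_bounded_integrable => //.
  apply: le_lt_trans mfin.
  by apply: le_measure; [exact: mem_set|exact: mem_set|exact: subsetT].
exists 1; split => // x x1 s; rewrite /= in_itv/= andbT => s0.
by rewrite (le_trans (g1 s s0))// ltW.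
Qed.

Let limit_eq (g : nat -> R -> R) (l : R -> R) :
  (forall n, measurable_fun H (g n : mR -> mR)) ->
  (forall n s, 0 <= s -> `|g n s| <= 1) ->
  (forall s, 0 <= s -> g n s @[n --> \oo] --> l s) ->
  (forall n, \int[m1]_(s in H) (g n s)%:E = \int[m2]_(s in H) (g n s)%:E)%E ->
  (\int[m1]_(s in H) (l s)%:E = \int[m2]_(s in H) (l s)%:E)%E.
Proof.
move=> mg g1 gl E.
have lim (m : {measure set mR -> \bar R}) : (m setT < +oo)%E ->
   (\int[m]_(s in H) (g n s)%:E)%E @[n --> \oo] --> (\int[m]_(s in H) (l s)%:E)%E.
  move=> mfin; apply: (@dominated_cvg _ _ _ m H mH (fun n s => (g n s)%:E) _ (cst 1%E)).
  - by move=> n; apply/measurable_EFinP; exact: mg.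
  - move=> s; rewrite /= in_itv/= andbT => s0; apply: cvg_EFin; first exact: nearW.
    exact: gl.
  - by [].
  - by apply: (fin_integrable (g := cst 1) mfin) => // s _; rewrite normr1.
  - by move=> n s; rewrite /= in_itv/= andbT => s0; rewrite lee_fin g1.
have := lim m2 m2fin; under eq_fun do rewrite -E; move=> h.
exact: (cvg_unique (@ereal_hausdorff R) (lim m1 m1fin) h).
Qed.

Let laplace0 lam : 0 <= lam ->
  (\int[m1]_(y in H) (expR (- (lam * y)))%:E = \int[m2]_(y in H) (expR (- (lam * y)))%:E)%E.
Proof.
rewrite le_eqVlt => /predU1P[<-|]; last exact: m12.
apply: (limit_eq (g := fun n s => expR (- (n.+1%:R^-1 * s)))).
- by move=> n; exact: measurable_expRNM.
- move=> n s s0; rewrite ger0_norm ?expR_ge0// -[leRHS]expR0 ler_expR oppr_le0.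
  by rewrite mulr_ge0// invr_ge0.
- move=> s s0; apply: continuous_cvg; first exact: continuous_expR.
  by apply: cvgN; apply: cvgMl; exact: cvg_harmonic.
- by move=> n; apply: m12; rewrite invr_gt0.
Qed.

(** The factor e^{-lam y} is there for the induction on [K]: splitting off one factor 1 - e^{-nu y}
    leaves two integrals of degree [K], with parameters [lam] and [lam + nu]. *)
Let laplace_onem (nu : R) K lam : 0 <= nu -> 0 <= lam ->
  (\int[m1]_(y in H) (expR (- (lam * y)) * (1 - expR (- (nu * y))) ^+ K)%:E =
   \int[m2]_(y in H) (expR (- (lam * y)) * (1 - expR (- (nu * y))) ^+ K)%:E)%E.
Proof.
move=> nu0; elim: K lam => [|K IH] lam lam0.
  under eq_integral do rewrite expr0 mulr1.
  by under [RHS]eq_integral do rewrite expr0 mulr1; exact: laplace0.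
have meas l : measurable_fun H
    ((fun y => expR (- (l * y)) * (1 - expR (- (nu * y))) ^+ K) : mR -> mR).
  apply: measurable_funM; first exact: measurable_expRNM.
  apply: (@measurable_funX _ mR R H (fun y => 1 - expR (- (nu * y))) K).
  apply: (@measurable_funB _ mR R H (cst 1) (fun y => expR (- (nu * y)))) => //.
  exact: measurable_expRNM.
have int (m : {measure set mR -> \bar R}) r : (m setT < +oo)%E -> 0 <= r ->
    m.-integrable H (EFin \o (fun y => expR (- (r * y)) * (1 - expR (- (nu * y))) ^+ K)).
  move=> mfin r0; apply: fin_integrable; [exact: mfin|exact: meas|move=> s s0].
  have h x : 0 <= x -> 0 < expR (- (x * s)) <= 1.
    by move=> x0; rewrite expR_gt0/= -[leRHS]expR0 ler_expR oppr_le0 mulr_ge0.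
  have /andP[h1 h2] := h r r0; have /andP[h3 h4] := h nu nu0.
  have o0 : 0 <= 1 - expR (- (nu * s)) by rewrite subr_ge0.
  have o1 : 1 - expR (- (nu * s)) <= 1 by rewrite lerBlDr lerDl ltW.
  rewrite ger0_norm; first by apply: mulr_ile1; rewrite ?exprn_ge0 ?exprn_ile1 ?(ltW h1).
  by rewrite mulr_ge0 ?exprn_ge0// ltW.
have split_ (m : {measure set mR -> \bar R}) : (m setT < +oo)%E ->
   (\int[m]_(y in H) (expR (- (lam * y)) * (1 - expR (- (nu * y))) ^+ K.+1)%:E =
    \int[m]_(y in H) (expR (- (lam * y)) * (1 - expR (- (nu * y))) ^+ K)%:E -
    \int[m]_(y in H) (expR (- ((lam + nu) * y)) * (1 - expR (- (nu * y))) ^+ K)%:E)%E.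
  move=> mfin; rewrite -integralB//=; [|exact: int|by apply: int; rewrite ?addr_ge0].
  apply: eq_integral => y _; rewrite -EFinB; congr EFin.
  by rewrite mulrDl opprD expRD exprS; ring.
by rewrite !split_// IH// IH// addr_ge0.
Qed.

Let laplace_onem0 (nu : R) K : 0 <= nu ->
  (\int[m1]_(y in H) ((1 - expR (- (nu * y))) ^+ K)%:E =
   \int[m2]_(y in H) ((1 - expR (- (nu * y))) ^+ K)%:E)%E.
Proof.
move=> nu0; have := laplace_onem K nu0 (lexx 0).
have E (m : {measure set mR -> \bar R}) :
    (\int[m]_(y in H) (expR (- (0 * y)) * (1 - expR (- (nu * y))) ^+ K)%:E =
     \int[m]_(y in H) ((1 - expR (- (nu * y))) ^+ K)%:E)%E.
  by apply: eq_integral => y _; rewrite mul0r oppr0 expR0 mul1r.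
by rewrite !E.
Qed.

Let laplace_tail t : 0 <= t -> m1 `]t, +oo[%classic = m2 `]t, +oo[%classic.
Proof.
move=> t0; have sH : `]t, +oo[%classic `&` H = `]t, +oo[%classic.
  by apply: setIidl => s; rewrite /= !in_itv/= !andbT => /ltW; exact: le_trans.
have mt : measurable (`]t, +oo[%classic : set mR) by exact: measurable_itv.
rewrite -sH -[LHS]integral_indic// -[RHS]integral_indic//.
move: t0; rewrite le_eqVlt => /predU1P[<-|t0].
  (* [laplace_kernel] involves a division by t; at t = 0 these functions increase to the indicator
     of s > 0. *)
  apply: (limit_eq (g := fun n s => 1 - expR (- (n%:R * s)))).
  - move=> n; apply: (@measurable_funB _ mR R H (cst 1) (fun s => expR (- (n%:R * s)))) => //.
    exact: measurable_expRNM.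
  - move=> n s s0; have h1 := expR_gt0 (- (n%:R * s)).
    have h2 : expR (- (n%:R * s)) <= 1 by rewrite -[leRHS]expR0 ler_expR oppr_le0 mulr_ge0.
    by rewrite ger0_norm ?subr_ge0// lerBlDr lerDl ltW.
  - move=> s; rewrite le_eqVlt => /predU1P[<-|s0].
      rewrite indicE memNset/= ?in_itv/= ?ltxx//.
      by under eq_fun do rewrite mulr0 oppr0 expR0 subrr; exact: cvg_cst.
    rewrite indicE mem_set/= ?in_itv/= ?s0// -[X in _ --> X]subr0.
    apply: cvgB; first exact: cvg_cst.
    have h : r * s @[r --> +oo] --> +oo by apply: (gt0_cvgMly s0); exact: cvg_id.
    exact: (cvg_comp _ _ (cvg_comp _ _ (@cvgr_idn R) h) (@cvgr_expR R)).
  - by move=> n; exact: (laplace_onem0 1 (ler0n _ n)).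
apply: (limit_eq (g := fun n => laplace_kernel n t)).
- move=> n; pose c := n%:R * (ln 2 / t).
  apply: (@measurable_funX _ mR R H (fun s => 1 - expR (- (c * s)))).
  apply: (@measurable_funB _ mR R H (cst 1) (fun s => expR (- (c * s)))) => //.
  exact: measurable_expRNM.
- by move=> n s s0; have /andP[h1 h2] := laplace_kernel01 n t0 s0; rewrite ger0_norm.
- by move=> s s0; exact: cvg_laplace_kernel.
- move=> n; apply: laplace_onem0.
  by rewrite mulr_ge0// divr_ge0 ?(ltW t0)// ln_ge0// ler1n.
Qed.

(** Open upper half-lines form a generating pi-system. Those starting at a < 0 carry the mass of [0,
    oo), which is the Laplace transform at 0. *)
Lemma laplace_unique (B : set mR) : measurable B -> m1 B = m2 B.
Proof.
have tailH (m : {measure set mR -> \bar R}) a : m `]-oo, 0[%classic = 0%E -> a < 0 ->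
    m `]a, +oo[%classic = m H.
  move=> m0 a0; have -> : (`]a, +oo[%classic : set mR) = `]a, 0[%classic `|` H.
    apply/seteqP; split=> s; rewrite /= !in_itv/= !andbT.
      by move=> h; have [s0|s0] := ltP s 0; [left; rewrite h|right].
    by move=> [/andP[]//|]; exact: lt_le_trans.
  rewrite measureU//; last first.
    by apply/seteqP; split=> s //=; rewrite !in_itv/= andbT => -[/andP[_ h1]]; rewrite leNgt h1.
  rewrite [X in (X + _)%E](_ : _ = 0%E) ?add0e//.
  apply/eqP; rewrite -measure_le0 -m0; apply: le_measure; [exact: mem_set|exact: mem_set|].
  by move=> s; rewrite /= !in_itv/= => /andP[].
have mHH : m1 H = m2 H.
  have := laplace0 (lexx 0).
  have E (m : {measure set mR -> \bar R}) :
      (\int[m]_(y in H) (expR (- (0 * y)))%:E)%E = m H.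
    rewrite -[RHS]mul1e -(integral_cst m mH 1%E).
    by apply: eq_integral => y _; rewrite mul0r oppr0 expR0.
  by rewrite !E.
move=> mB; pose G := [set A : set mR | exists a : R, A = `]a, +oo[%classic].
apply: (@measure_unique _ R mR G (fun k => `](- k%:R : R), +oo[%classic)) => //.
- exact: RGenOInfty.measurableE.
- move=> _ _ [a ->] [b ->]; exists (Num.max a b).
  by apply/seteqP; split=> s; rewrite /= !in_itv/= !andbT gt_max; [move=> [-> ->]|move=> /andP[]].
- by move=> k; exists (- k%:R).
- apply/seteqP; split=> // s _; exists (Num.truncn `|s|).+1 => //=.
  rewrite in_itv/= andbT ltrNl; apply: le_lt_trans (truncnS_gt _).
  by rewrite -normrN ler_norm.
- move=> _ [a ->]; have [a0|a0] := ltP a 0; last exact: laplace_tail.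
  by rewrite !tailH.
- move=> k; apply: le_lt_trans m1fin.
  by apply: le_measure; [exact: mem_set|exact: mem_set|exact: subsetT].
Qed.

End finite_measures.
End laplace_uniqueness.

(** * The mass process *)

Section mass_law.
Context (R : realType) d (E : measurableType d) (mass : E -> \bar R).
Local Notation mR := (measurableTypeR R).
Local Notation H := (`[0, +oo[%classic : set mR).

Let mH : measurable H. Proof. exact: measurable_itv. Qed.

(** Infinite masses are left out, so the laws built on it are in general only sub-probabilities. *)
Definition finite_mass_in (B : set mR) : set E := mass @^-1` (EFin @` B).

Lemma measurable_finite_mass_in B : measurable_fun setT mass -> measurable B ->
  measurable (finite_mass_in B).
Proof.
move=> mmass mB; rewrite -[finite_mass_in B]setTI; apply: mmass => //.
exact: measurable_image_EFin.
Qed.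

(* The unused first argument makes the canonical measure structure inferable. *)
Definition mass_law (mmass : measurable_fun setT mass) (m : {measure set E -> \bar R})
  (B : set mR) : \bar R := m (finite_mass_in B).

Section measure.
Variables (mmass : measurable_fun setT mass) (m : {measure set E -> \bar R}).

Let mass_law0 : mass_law mmass m set0 = 0%E.
Proof. by rewrite /mass_law /finite_mass_in image_set0 preimage_set0 measure0. Qed.

Let mass_law_ge0 B : (0 <= mass_law mmass m B)%E.
Proof. exact: measure_ge0. Qed.

Let mass_law_sigma_additive : semi_sigma_additive (mass_law mmass m).
Proof.
move=> F mF tF mUF; rewrite /mass_law /finite_mass_in image_bigcup preimage_bigcup.
apply: measure_semi_sigma_additive.
- by move=> i; exact: measurable_finite_mass_in.
- move=> i j _ _ [x [[a Fia ax] [b Fjb bx]]]; apply: (tF i j I I); exists a.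
  by split => //; move: bx; rewrite -ax => -[<-].
- by apply: bigcup_measurable => i _; exact: measurable_finite_mass_in.
Qed.

HB.instance Definition _ := isMeasure.Build _ _ _ (mass_law mmass m)
  mass_law0 mass_law_ge0 mass_law_sigma_additive.

Lemma mass_law_neg : (forall x, 0 <= mass x)%E -> mass_law mmass m (~` H) = 0%E.
Proof.
move=> mass0; rewrite /mass_law (_ : finite_mass_in _ = set0) ?measure0//.
apply/seteqP; split => // x [r /= nr rx]; apply: nr; rewrite in_itv/= andbT.
by rewrite -lee_fin rx.
Qed.

Lemma integral_mass_law (g : mR -> \bar R) : (forall x, 0 <= mass x)%E ->
  measurable_fun H g -> (forall r, 0 <= r -> (0 <= g r)%E) ->
  (\int[mass_law mmass m]_(r in H) g r =
   \int[m]_x if mass x is r%:E then g r else 0)%E.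
Proof.
move=> mass0 mg g0.
(* sending infinite masses to -1 turns the law on [H] into an image measure *)
pose h (y : \bar R) : mR := if y is r%:E then r else -1.
have mh : measurable_fun setT h.
  move=> _ B mB; rewrite setTI.
  rewrite (_ : h @^-1` B = EFin @` B `|`
      (if -1 \in B then [set +oo%E; -oo%E] else set0)); last first.
    apply/seteqP; split=> [[r| |] /= hB|y].
    - by left; exists r.
    - by right; rewrite mem_set//; left.
    - by right; rewrite mem_set//; right.
    - case=> [[r Br <-]//|]; case: ifPn => // /set_mem B1.
      by case=> ->.
  apply: measurableU; first exact: measurable_image_EFin.
  by case: ifP => // _; apply: measurableU; exact: emeasurable_set1.
have mhm : measurable_fun setT (h \o mass) by exact: measurableT_comp.
have hH y : (0 <= y)%E -> H (h y) -> y = (h y)%:E.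
  by case: y => //= _; rewrite in_itv/= andbT ler0N1.
rewrite (eq_measure_integral (pushforward m (h \o mass))); last first.
  move=> A mA AH; rewrite /= /mass_law /pushforward /finite_mass_in; congr (m _).
  apply/seteqP; split=> x /=; first by move=> [r Ar <-].
  by move=> Ax; exists (h (mass x)) => //; rewrite -hH//; exact: AH.
rewrite ge0_integral_pushforward//; last first.
  by move=> y /set_mem; rewrite /= in_itv/= andbT; exact: g0.
rewrite integral_mkcond; apply: eq_integral => x _; rewrite patchE.
have := mass0 x; case Em: (mass x) => [r| |] //= r0.
  by rewrite mem_set/= ?Em//= in_itv/= andbT -lee_fin.
by rewrite memNset//= Em/= in_itv/= andbT ler0N1.
Qed.

End measure.

Definition mass_kernel (mmass : measurable_fun setT mass) (i : mR -> E)
  (mi : measurable_fun setT i) (K : R.-spker E ~> E) (x : mR) :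
  {measure set mR -> \bar R} := mass_law mmass (K (i x)).

Section kernel.
Variables (mmass : measurable_fun setT mass) (i : mR -> E).
Variables (mi : measurable_fun setT i) (K : R.-spker E ~> E).

Let measurable_mass_kernel U : measurable U ->
  measurable_fun setT (mass_kernel mmass mi K ^~ U).
Proof.
move=> mU; apply: (measurableT_comp (f := fun y => K y (finite_mass_in U))) => //.
by apply: measurable_kernel; exact: measurable_finite_mass_in.
Qed.

HB.instance Definition _ := isKernel.Build _ _ _ _ _ (mass_kernel mmass mi K)
  measurable_mass_kernel.

Let mass_kernel_le1 :
  (ereal_sup [set mass_kernel mmass mi K x setT | x in setT] <= 1)%E.
Proof.
apply: ub_ereal_sup => _ [x _ <-]; apply: le_trans (sprob_kernel_le1 K (i x)).
apply: le_measure; [|exact: mem_set|exact: subsetT].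
by apply: mem_set; exact: measurable_finite_mass_in.
Qed.

HB.instance Definition _ := Kernel_isSubProbability.Build _ _ _ _ _
  (mass_kernel mmass mi K) mass_kernel_le1.

End kernel.
End mass_law.

(** * Laplace transform of the mass under the semigroups *)

Section mass_laplace.
Context (R : realType).
Local Notation mR := (measurableTypeR R).
Local Notation H := (`[0, +oo[%classic : set mR).

Let mH : measurable H. Proof. exact: measurable_itv. Qed.

(** [mass_limit] is used twice, with [psi] under the integral, where 1 dominates, and with [psi'] at
    the initial state; [D] is the immigration term. Since [psi <= psi'], the same slope keeps the
    second source nonnegative, and [psi' c] is positive. *)
Lemma kernel_mass_laplace d (E : measurableType d) (K : R.-spker E ~> E) (x : E)
    (ms : E -> {measure set mR -> \bar R}) (W : E -> R -> R)
    (psi psi' : R -> R) (c k D : R) :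
  (forall y N, (ms y `[0%R, N]%classic < +oo)%E) ->
  (forall y, measurable_fun H (W y : mR -> mR)) ->
  (forall y t, 0 <= t -> 0 <= W y t) ->
  (forall y N, exists B, forall t, 0 <= t <= N -> W y t <= B) ->
  locally_lipschitz psi -> psi 0 = 0 -> locally_lipschitz psi' -> psi' 0 = 0 ->
  0 < c -> 0 < k -> 0 < psi c -> (forall t, 0 <= t -> psi t <= psi' t) ->
  (forall t, 0 <= t <= c -> - k <= psi t) ->
  (forall n, measurable_fun setT (fun y : E =>
     \int[ms y]_(s in H) (ramp_source psi c k n s * W y s) : mR)) ->
  (forall n, \int[K x]_y
       (expR (- \int[ms y]_(s in H) (ramp_source psi c k n s * W y s))%R)%:E =
     (expR (D - \int[ms x]_(s in H) (ramp_source psi' c k n s * W x s))%R)%:E)%E ->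
  (\int[K x]_y (laplace_exp (psi c) (\int[ms y]_(s in H) (W y s)%:E))%:E =
   (expR D * laplace_exp (psi' c) (\int[ms x]_(s in H) (W x s)%:E))%:E)%E.
Proof.
move=> ms_fin mW W0 Wb psiL psi0 psi'L psi'0 c0 k0 psic psi_le psik meas Lap.
have psi'c : 0 < psi' c by apply: lt_le_trans psic _; apply: psi_le; exact: ltW.
have src n s : 0 <= ramp_source psi c k n s by apply: ramp_source_ge0 => //; exact: ltW.
have src' n s : 0 <= ramp_source psi' c k n s.
  apply: ramp_source_ge0 => //; first exact: ltW.
  by move=> t tc; apply: (le_trans (psik t tc)); apply: psi_le; case/andP: tc.
have K1 := sprob_kernel_le1 K x.
have lhs : (\int[K x]_y
       (expR (- \int[ms y]_(s in H) (ramp_source psi c k n s * W y s))%R)%:E)%E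
    @[n --> \oo] -->
  (\int[K x]_y (laplace_exp (psi c) (\int[ms y]_(s in H) (W y s)%:E))%:E)%E.
  apply: (@dominated_cvg _ _ _ (K x) setT measurableT
    (fun n y => (expR (- \int[ms y]_(s in H) (ramp_source psi c k n s * W y s))%R)%:E)
    _ (cst 1%E)) => //.
  - move=> n; apply/measurable_EFinP; apply: measurableT_comp => //.
    by apply: measurable_funN; exact: meas.
  - move=> y _; apply: cvg_EFin; first exact: nearW.
    exact: (mass_limit (ms_fin y) (mW y) (W0 y) (Wb y) psiL psi0 c0 k0 psic src).
  - apply/integrableP; split => //.
    under eq_integral do rewrite abse1.
    by rewrite integral_cst// mul1e (le_lt_trans K1)// ltry.
  - move=> n y _; rewrite lee_fin ger0_norm ?expR_ge0//.
    rewrite -[leRHS]expR0 ler_expR oppr_le0; apply: Rintegral_ge0 => s.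
    by rewrite /= in_itv/= andbT => s0; rewrite mulr_ge0// W0.
have rhs : (expR (D - \int[ms x]_(s in H) (ramp_source psi' c k n s * W x s))%R)%:E
    @[n --> \oo] -->
    (expR D * laplace_exp (psi' c) (\int[ms x]_(s in H) (W x s)%:E))%:E.
  apply: cvg_EFin; first exact: nearW.
  under eq_fun do rewrite expRD.
  apply: cvgMr.
  exact: (mass_limit (ms_fin x) (mW x) (W0 x) (Wb x) psi'L psi'0 c0 k0 psi'c src').
move: lhs; under eq_fun do rewrite Lap; move=> lhs.
exact: (cvg_unique (@ereal_hausdorff R) lhs rhs).
Qed.

Lemma admissible_family_lip (T : set R) (phi : R -> R -> R) q :
  admissible_family T phi -> T q -> locally_lipschitz (phi q) /\ phi q 0 = 0.
Proof.
move=> [sigma [b [m [beta [n [[hm hphi] _ _ _ _]]]]]] Tq; split; last first.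
  by rewrite hphi// branching_mechanism0.
move=> C; have [L L0 HL] := branching_mechanism_lip (b q) (hm q Tq) C.
exists L => // x y xC yC; rewrite !hphi//; first exact: HL.
  by case/andP: yC.
by case/andP: xC.
Qed.

Lemma admissible_family_homo (T : set R) (phi : R -> R -> R) p q t :
  admissible_family T phi -> T p -> T q -> p <= q -> 0 <= t -> phi q t <= phi p t.
Proof. by move=> [? [? [? [? [? [_ h _ _ _]]]]]]; exact: h. Qed.

Definition has_mass_laplace (T : set R) (phi : R -> R -> R) (mu : R -> R)
    d (E : measurableType d) (mass : E -> \bar R) (K : R -> R -> R.-spker E ~> E) :=
  forall p q x lam, T p -> T q -> p <= q -> 0 < lam ->
    (\int[K p q x]_y (laplace_exp lam (mass y))%:E =
     (expR (- (mu q - mu p) * phi_inv (phi q) lam) *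
      laplace_exp (phi p (phi_inv (phi q) lam)) (mass x))%:E)%E.

Section families.
Variables (T : set R) (phi : R -> R -> R) (mu : R -> R).
Hypothesis hphi : admissible_family T phi.
Hypothesis hphi_oo : forall q, T q -> phi q lam @[lam --> +oo] --> +oo.

Lemma phi_lower_bound q c : T q -> exists2 k, 0 < k &
  forall t, 0 <= t <= c -> - k <= phi q t.
Proof.
move=> Tq; have [qL q0] := admissible_family_lip hphi Tq.
have [L L0 HL] := qL c; exists (L * `|c| + 1); first by rewrite ltr_wpDl// mulr_ge0.
move=> t tc; have /andP[t0 tc'] := tc.
have c0 : 0 <= c := le_trans t0 tc'.
have := HL t 0 tc; rewrite lexx c0 q0 !subr0 => /(_ isT).
rewrite ler_norml => /andP[h _]; apply: le_trans h; rewrite lerN2 (ger0_norm t0) (ger0_norm c0).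
by rewrite ler_wpDr// ler_wpM2l.
Qed.

Lemma Q_mass_laplace (Q : R -> R -> R.-spker (radonType R) ~> (radonType R)) :
  Q_laplace T phi mu Q -> has_mass_laplace T phi mu (@radon_mass R) Q.
Proof.
move=> hQL p q x lam Tp Tq pq lam0.
have [qL q0] := admissible_family_lip hphi Tq.
have [pL p0] := admissible_family_lip hphi Tp.
have phiq_oo := hphi_oo Tq.
set c := phi_inv (phi q) lam.
have c0 : 0 < c by exact: phi_inv_gt0.
have qc : phi q c = lam by apply: phi_invK => //; exact: ltW.
have [k k0 Hk] := phi_lower_bound c Tq.
have massE (y : radonType R) :
    (\int[radon_val y]_(s in H) ((cst 1 : R -> R) s)%:E)%E = radon_mass y.
  by rewrite -[RHS]mul1e -(integral_cst (radon_val y) mH 1%E).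
have fE (y : radonType R) (f : R -> R) :
    \int[radon_val y]_(s in H) (f s * (cst 1 : R -> R) s) = \int[radon_val y]_(s in H) f s.
  by apply: eq_Rintegral => s _; rewrite mulr1.
have := @kernel_mass_laplace _ _ (Q p q) x (fun y => radon_val y) (fun _ => cst 1)
  (phi q) (phi p) c k (- (mu q - mu p) * c).
under eq_integral do rewrite massE qc.
rewrite massE; apply => //.
- by move=> y N; exact: radon_fin.
- by exists 1.
- by rewrite qc.
- by move=> t t0; exact: (admissible_family_homo hphi).
- move=> n; under eq_fun do rewrite fE.
  exact: measurable_radon_ramp_source.
- move=> n; under eq_integral do rewrite fE.
  rewrite hQL//; last first.
    by apply: ramp_source_bounded_pos_csupp => //; rewrite qc ltW.
  (* The immigration term involves the solution at time 0, where the ramp equals c for every n. *)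
  congr (expR _)%:E; rewrite fE u_ramp_source// ramp_before//; congr (_ - _).
  apply: eq_Rintegral => s /set_mem; rewrite /= in_itv/= andbT => s0.
  exact: u2_ramp_source.
Qed.

Lemma P_mass_laplace (P : R -> R -> R.-spker (cadlagType R) ~> (cadlagType R)) :
  P_laplace T phi mu P -> has_mass_laplace T phi mu (@path_mass R) P.
Proof.
move=> hPL p q x lam Tp Tq pq lam0.
have [qL q0] := admissible_family_lip hphi Tq.
have [pL p0] := admissible_family_lip hphi Tp.
have phiq_oo := hphi_oo Tq.
set c := phi_inv (phi q) lam.
have c0 : 0 < c by exact: phi_inv_gt0.
have qc : phi q c = lam by apply: phi_invK => //; exact: ltW.
have [k k0 Hk] := phi_lower_bound c Tq.
have src n : bounded_pos_csupp (ramp_source (phi q) c k n).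
  by apply: ramp_source_bounded_pos_csupp => //; rewrite qc ltW.
have := @kernel_mass_laplace _ _ (P p q) x (fun _ => @lebesgue_measure R)
  (fun w => cadlag_val w) (phi q) (phi p) c k (- (mu q - mu p) * c).
rewrite qc; apply => //.
- by move=> _ N; exact: lebesgue_itv0_fin.
- by move=> y; apply: measurable_funTS; exact: measurable_cadlag.
- by move=> y t; exact: cadlag_ge0.
- exact: cadlag_bounded.
- by move=> t t0; exact: (admissible_family_homo hphi).
- move=> n; apply: (measurableT_comp (f := fine)) => //.
  by have [mf f0 _ _] := src n; exact: measurable_cadlag_integral.
- move=> n; rewrite hPL//.
  congr (expR _)%:E; rewrite u_ramp_source// ramp_before//; congr (_ - _).
  apply: eq_Rintegral => s /set_mem; rewrite /= in_itv/= andbT => s0.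
  by congr (_ * _); exact: u2_ramp_source.
Qed.

End families.
End mass_laplace.

(** * The semigroup of the mass and its Markov property *)

Section total_mass.
Context (R : realType).
Local Notation mR := (measurableTypeR R).
Local Notation H := (`[0, +oo[%classic : set mR).

Let mH : measurable H. Proof. exact: measurable_itv. Qed.

Lemma mass_law_setT_fin d (E : measurableType d) (mass : E -> \bar R)
    (mmass : measurable_fun setT mass) (K : R.-spker E ~> E) x :
  (mass_law mmass (K x) setT < +oo)%E.
Proof.
apply: le_lt_trans (ltry 1); apply: le_trans (sprob_kernel_le1 K x).
apply: le_measure; [|exact: mem_set|exact: subsetT].
by apply: mem_set; exact: measurable_finite_mass_in.
Qed.

Lemma mass_law_neg0 d (E : measurableType d) (mass : E -> \bar R)
    (mmass : measurable_fun setT mass) (m : {measure set E -> \bar R}) :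
  (forall x, 0 <= mass x)%E -> mass_law mmass m `]-oo, 0[%classic = 0%E.
Proof.
move=> mass0; apply/eqP; rewrite -measure_le0 -(mass_law_neg mmass m mass0).
apply: le_measure; [exact: mem_set| |].
  by apply: mem_set; exact: measurableC.
by move=> s; rewrite /= !in_itv/= andbT ltNge => /negP.
Qed.

Lemma laplace_mass_law d (E : measurableType d) (mass : E -> \bar R)
    (mmass : measurable_fun setT mass) (m : {measure set E -> \bar R}) lam :
  (forall x, 0 <= mass x)%E ->
  (\int[mass_law mmass m]_(y in H) (expR (- (lam * y)))%:E =
   \int[m]_x (laplace_exp lam (mass x))%:E)%E.
Proof.
move=> mass0; rewrite integral_mass_law//.
- by apply: eq_integral => x _; rewrite /laplace_exp; case: (mass x).
- by apply/measurable_EFinP; exact: measurable_expRNM.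
Qed.

Lemma radon_mass_ge0 (nu : radonType R) : (0 <= radon_mass nu)%E.
Proof. exact: measure_ge0. Qed.

Lemma path_mass_ge0 (w : cadlagType R) : (0 <= path_mass w)%E.
Proof.
apply: integral_ge0 => s; rewrite /= in_itv/= andbT lee_fin; exact: cadlag_ge0.
Qed.

Variables (T : set R) (phi : R -> R -> R) (mu : R -> R).
Variable Q : R -> R -> R.-spker (radonType R) ~> (radonType R).
Hypothesis hphi : admissible_family T phi.
Hypothesis hphi_oo : forall q, T q -> phi q lam @[lam --> +oo] --> +oo.
Hypothesis hQ : transition_semigroup T setT Q.
Hypothesis hQL : Q_laplace T phi mu Q.

Definition mass_semigroup p q : R.-spker mR ~> mR :=
  mass_kernel (@measurable_radon_mass R) (@measurable_radon_at0 R) (Q p q).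

Let QL := Q_mass_laplace hphi hphi_oo hQL.

(** This is the lumping property: the initial state enters the Laplace transform through its mass
    only, and so do the laws. From infinite mass the transform is 0, so the law is compared with the
    zero measure and the mass almost surely stays infinite. *)
Lemma mass_law_semigroup d (E : measurableType d) (mass : E -> \bar R)
    (mmass : measurable_fun setT mass) (K : R -> R -> R.-spker E ~> E) p q x B :
  (forall x, 0 <= mass x)%E -> has_mass_laplace T phi mu mass K ->
  T p -> T q -> p <= q -> measurable B ->
  K p q x (finite_mass_in mass B) =
  if mass x is r%:E then mass_semigroup p q r B else 0%E.
Proof.
move=> mass0 KL Tp Tq pq mB; rewrite -/(mass_law mmass (K p q x) B).
have := mass0 x; case E0: (mass x) => [r| |]// r0.
  apply: (@laplace_unique R (mass_law mmass (K p q x))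
    (mass_law (@measurable_radon_mass R) (Q p q (radon_at0 r)))) => //.
  - exact: mass_law_setT_fin.
  - exact: mass_law_setT_fin.
  - exact: mass_law_neg0.
  - by apply: mass_law_neg0; exact: radon_mass_ge0.
  - move=> lam lam0; rewrite (laplace_mass_law _ _ _ mass0) (laplace_mass_law _ _ _ radon_mass_ge0).
    by rewrite KL// QL// radon_mass_at0 E0 ger0_norm// -lee_fin.
have -> : 0%E = (@mzero _ mR R) B by [].
apply: laplace_unique => //.
- exact: mass_law_setT_fin.
- exact: mass_law_neg0.
- move=> lam lam0; rewrite laplace_mass_law// KL// E0/= mulr0.
  by rewrite integral_measure_zero.
Qed.

(** In the Chapman-Kolmogorov equation of [Q] the inner kernel depends on the intermediate measure
    through its mass, so the integral is one against the law of that mass; intermediate measures of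
    infinite mass contribute 0. *)
Lemma mass_semigroup_transition : transition_semigroup T H mass_semigroup.
Proof.
have [_ Q1 Q2] := hQ; split.
- by move=> p q x _ _ _ _; exact: (mass_law_neg _ _ radon_mass_ge0).
- move=> p x B Tp x0 mB.
  have mB' := measurable_finite_mass_in (@measurable_radon_mass R) mB.
  rewrite [LHS](Q1 p (radon_at0 x) _ Tp I mB') !diracE; congr ((nat_of_bool _)%:R%:E).
  move: x0; rewrite /= in_itv/= andbT => x0.
  apply/idP/idP => /set_mem h; apply/mem_set.
    by case: h => r Br; rewrite radon_mass_at0 ger0_norm// => -[<-].
  by exists x => //; rewrite radon_mass_at0 ger0_norm.
- move=> p q r x B Tp Tq Tr pq qr x0 mB.
  have mB' := measurable_finite_mass_in (@measurable_radon_mass R) mB.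
  rewrite [LHS](Q2 p q r (radon_at0 x) _ Tp Tq Tr pq qr I mB').
  rewrite [RHS](integral_mass_law _ _ radon_mass_ge0)//.
  + apply: eq_integral => nu _.
    by rewrite (mass_law_semigroup (@measurable_radon_mass R) nu radon_mass_ge0 QL).
  + by apply: measurable_funTS; exact: measurable_kernel.
Qed.

Lemma mass_semigroup_laplace p q lam x : T p -> T q -> p <= q -> 0 <= lam -> 0 <= x ->
  (\int[mass_semigroup p q x]_(y in H) (expR (- (lam * y)))%:E)%E =
  (expR (- (x * phi p (phi_inv (phi q) lam)) - (mu q - mu p) * phi_inv (phi q) lam))%:E.
Proof.
move=> Tp Tq pq + x0.
have pos l : 0 < l -> (\int[mass_semigroup p q x]_(y in H) (expR (- (l * y)))%:E)%E =
  (expR (- (x * phi p (phi_inv (phi q) l)) - (mu q - mu p) * phi_inv (phi q) l))%:E.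
  move=> l0; rewrite [LHS](laplace_mass_law _ _ _ radon_mass_ge0).
  by rewrite QL// radon_mass_at0 ger0_norm//= -expRD; congr (expR _)%:E; ring.
(* For lambda = 0 both sides are limits along 1/(k+1): dominated convergence on the left, right
   continuity of the inverse and continuity of [phi p] on the right. *)
rewrite le_eqVlt => /predU1P[<-|]; last exact: pos.
have [qL q0] := admissible_family_lip hphi Tq.
have [pL p0] := admissible_family_lip hphi Tp.
have cv := cvg_phi_inv0 (hphi_oo Tq).
pose l k : R := k.+1%:R^-1.
have lhs : (\int[mass_semigroup p q x]_(y in H) (expR (- (l k * y)))%:E)%E @[k --> \oo] -->
    (\int[mass_semigroup p q x]_(y in H) (expR (- (0 * y)))%:E)%E.
  apply: (@dominated_cvg _ _ _ (mass_semigroup p q x) H mH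
    (fun k y => (expR (- (l k * y)))%:E) _ (cst 1%E)) => //.
  - by move=> n; apply/measurable_EFinP; exact: measurable_expRNM.
  - move=> y _; apply: cvg_EFin; first exact: nearW.
    apply: continuous_cvg; first exact: continuous_expR.
    by apply: cvgN; apply: cvgMl; exact: cvg_harmonic.
  - apply/integrableP; split; first exact: measurable_cst.
    under eq_integral do rewrite abse1.
    rewrite integral_cst// mul1e.
    apply: (@le_lt_trans _ _ (mass_semigroup p q x setT)); last exact: mass_law_setT_fin.
    by apply: le_measure; [exact: mem_set|exact: mem_set|exact: subsetT].
  - move=> n y; rewrite /= in_itv/= andbT => y0; rewrite lee_fin ger0_norm ?expR_ge0//.
    by rewrite -[leRHS]expR0 ler_expR oppr_le0 mulr_ge0// invr_ge0.
have rhs : (expR (- (x * phi p (phi_inv (phi q) (l k))) -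
      (mu q - mu p) * phi_inv (phi q) (l k)))%:E @[k --> \oo] -->
    (expR (- (x * phi p (phi_inv (phi q) 0)) - (mu q - mu p) * phi_inv (phi q) 0))%:E.
  apply: cvg_EFin; first exact: nearW.
  apply: continuous_cvg; first exact: continuous_expR.
  apply: cvgB; last by apply: cvgMr; exact: cv.
  apply: cvgN; apply: cvgMr.
  have ge0 k : 0 <= phi_inv (phi q) k by exact: (phi_inv_ge0 (hphi_oo Tq)).
  have := continuous_cvg _ (@continuous_phi_max _ (phi p) pL (phi_inv (phi q) 0)) cv.
  have -> : (fun k => phi p (phi_inv (phi q) (l k))) =
      (fun k => phi p (Num.max 0 (phi_inv (phi q) (l k)))).
    by apply/funext => k; rewrite max_r.
  have -> : Num.max 0 (phi_inv (phi q) 0) = phi_inv (phi q) 0 by rewrite max_r.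
  exact.
move: lhs; under eq_fun do rewrite pos ?invr_gt0//; move=> lhs.
exact: (cvg_unique (@ereal_hausdorff R) lhs rhs).
Qed.

(* The mass of the cemetery is infinite, hence the cemetery and the points of
   infinite mass are sent to the cemetery of the mass process. *)
Lemma total_mass_markov d (E : measurableType d) (mass : E -> \bar R)
    (mmass : measurable_fun setT mass) (S : set E) (K : R -> R -> E -> set E -> \bar R)
    d' (Om : measurableType d') (Pr : probability Om R)
    (Z : R -> Om -> option E) (sigma : R -> Om -> \bar R) :
  (forall x, 0 <= mass x)%E ->
  (forall p q x B, T p -> T q -> p <= q -> measurable B ->
     K p q x (finite_mass_in mass B) =
     if mass x is r%:E then mass_semigroup p q r B else 0%E) ->
  markov_process T S K Pr Z ->
  (forall q w, T q -> sigma q w = total_mass mass (Z q w)) ->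
  markov_process T H (fun p q x B => mass_semigroup p q x B) Pr
    (fun q w => Rplus_state (sigma q w)).
Proof.
move=> mass0 massK [_ Zmeas Zmarkov] sigmaE.
have preE q B : T q -> (fun w => Rplus_state (sigma q w)) @^-1` (some @` B) =
    Z q @^-1` (some @` finite_mass_in mass B).
  move=> Tq; apply/seteqP; split=> w /=; rewrite sigmaE//.
    case: (Z q w) => [z|] /= [r Br]//; case E0: (mass z) => [s| |]//= -[rs].
    by exists z => //; exists r => //; rewrite E0 rs.
  by move=> [z [r Br rz] <-] /=; exists r; rewrite // -rz.
split.
- move=> q w x Tq; rewrite sigmaE// /= in_itv/= andbT.
  case: (Z q w) => [z|]//=; have := mass0 z; case: (mass z) => [s| |]//= s0 [<-].
  by rewrite -lee_fin.
- move=> q B Tq mB; rewrite preE//; apply: Zmeas => //.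
  exact: measurable_finite_mass_in.
- move=> p q B G Tp Tq pq mB FG; rewrite preE// (Zmarkov p q)//; last 2 first.
  + exact: measurable_finite_mass_in.
  (* The filtration of the mass process is contained in that of [Z], so the events to be tested are
     among those covered by the Markov property of [Z]. *)
  + move: G FG; apply: sub_sigma_algebra2 => A [r [C [Tr rp mC ->]]].
    exists r, (finite_mass_in mass C); split => //; last exact: preE.
    exact: measurable_finite_mass_in.
  apply: eq_integral => w _; rewrite sigmaE//; case: (Z p w) => [z|]//=.
  by rewrite massK//; case: (mass z).
Qed.

End total_mass.

(** Hence killing a process when its mass becomes infinite does not alter the law of the finite part
    of the mass, and the restricted semigroups yield the same mass semigroup. *)
Lemma finite_mass_inI (R : realType) d (E : measurableType d) (mass : E -> \bar R)
    (B : set (measurableTypeR R)) :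
  finite_mass_in mass B `&` [set x | (mass x < +oo)%E] = finite_mass_in mass B.
Proof. by apply: setIidl => x [r _ /= <-]; exact: ltry. Qed.

Theorem theorem4p7 (R : realType) (T : set R) (phi : R -> R -> R) (mu : R -> R)
  (Q : R -> R -> R.-spker (radonType R) ~> (radonType R))
  (P : R -> R -> R.-spker (cadlagType R) ~> (cadlagType R))
  (hT : is_interval T)
  (hphi : admissible_family T phi)
  (hmu : immigration_function T mu)
  (hQ : transition_semigroup T setT Q)
  (hQ1 : conservative T Q)
  (hQL : Q_laplace T phi mu Q)
  (hP : transition_semigroup T setT P)
  (hP1 : conservative T P)
  (hPL : P_laplace T phi mu P)
  (hphi_oo : forall q, T q -> phi q lam @[lam --> +oo] --> +oo) :
  exists Rk : R -> R -> R.-spker (measurableTypeR R) ~> (measurableTypeR R),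
    [/\ transition_semigroup T (`[0, +oo[ : set (measurableTypeR R)) Rk,
        forall p q lam (x : measurableTypeR R),
          T p -> T q -> p <= q -> 0 <= lam -> 0 <= x ->
          (\int[Rk p q x]_(y in `[0%R, +oo[) (expR (- (lam * y)))%:E)%E
          = (expR (- (x * phi p (phi_inv (phi q) lam))
                   - (mu q - mu p) * phi_inv (phi q) lam))%:E &
        forall (d : measure_display) (Om : measurableType d)
          (Pr : probability Om R) (sigma : R -> Om -> \bar R),
          [\/ exists2 Z : R -> Om -> radonType R,
                markov_process T setT (fun p q x B => Q p q x B) Pr
                  (fun q w => Some (Z q w)) &
                forall q w, T q -> sigma q w = radon_mass (Z q w),
              exists2 Z : R -> Om -> option (radonType R),
                markov_process T (@finite_measures R)
                  (restrict_kernel (@finite_measures R) Q) Pr Z &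
                forall q w, T q ->
                  sigma q w = total_mass (@radon_mass R) (Z q w),
              exists2 X : R -> Om -> cadlagType R,
                markov_process T setT (fun p q x B => P p q x B) Pr
                  (fun q w => Some (X q w)) &
                forall q w, T q -> sigma q w = path_mass (X q w) |
              exists2 X : R -> Om -> option (cadlagType R),
                markov_process T (@integrable_paths R)
                  (restrict_kernel (@integrable_paths R) P) Pr X &
                forall q w, T q ->
                  sigma q w = total_mass (@path_mass R) (X q w)] ->
          markov_process T (`[0, +oo[ : set (measurableTypeR R))
            (fun p q x B => Rk p q x B) Pr (fun q w => Rplus_state (sigma q w))].
Proof.
have QL := Q_mass_laplace hphi hphi_oo hQL.
have PL := P_mass_laplace hphi hphi_oo hPL.
exists (mass_semigroup Q); split.
- exact: (mass_semigroup_transition hphi hphi_oo hQ hQL).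
- by move=> p q lam x; exact: (mass_semigroup_laplace hphi hphi_oo hQL).
- move=> d Om Pr sigma.
  have lawQ p q x B Tp Tq pq mB := mass_law_semigroup hphi hphi_oo hQL
    (@measurable_radon_mass R) (p := p) (q := q) x (B := B) (@radon_mass_ge0 R) QL Tp Tq pq mB.
  have lawP p q x B Tp Tq pq mB := mass_law_semigroup hphi hphi_oo hQL
    (@measurable_path_mass R) (p := p) (q := q) x (B := B) (@path_mass_ge0 R) PL Tp Tq pq mB.
  case=> [[Z Zm sE]|[Z Zm sE]|[X Xm sE]|[X Xm sE]].
  + apply: (total_mass_markov (@measurable_radon_mass R) (@radon_mass_ge0 R) _ Zm sE).
    by move=> p q x B Tp Tq pq mB; rewrite lawQ.
  + apply: (total_mass_markov (@measurable_radon_mass R) (@radon_mass_ge0 R) _ Zm sE).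
    by move=> p q x B Tp Tq pq mB; rewrite /restrict_kernel finite_mass_inI lawQ.
  + apply: (total_mass_markov (@measurable_path_mass R) (@path_mass_ge0 R) _ Xm sE).
    by move=> p q x B Tp Tq pq mB; rewrite lawP.
  + apply: (total_mass_markov (@measurable_path_mass R) (@path_mass_ge0 R) _ Xm sE).
    by move=> p q x B Tp Tq pq mB; rewrite /restrict_kernel finite_mass_inI lawP.
Qed.
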